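(* Let $\Gamma$ be a tournament limit represented by a tournament kernel $W$. The following are equivalent: (a) $\Gamma$ is irreducible; (b) $W$ is irreducible; (c) the random infinite tournament $G(\infty,W)$ is almost surely irreducible.
   Context: A tournament kernel on $(\mathcal S,\mu)$ is a measurable $W:\mathcal S^2\to[0,1]$ with $W(x,y)+W(y,x)=1$ a.e.; $W$ is irreducible if there is no measurable $B$ with $0<\mu(B)<1$ and $W=1$ a.e. on $B\times(\mathcal S\setminus B)$. Tournament limits are limits of sequences of finite tournaments $G_n$ with $v(G_n)\to\infty$ and convergent homomorphism densities, and are determined by the induced densities $t_{\mathrm{ind}}(F,\Gamma)=\lim\mathrm{ind}(F,G_n)/(v(G_n))_{v(F)}$ over finite tournaments $F$; $W$ represents $\Gamma$ if $t_{\mathrm{ind}}(F,\Gamma)=\int\prod_{(i,j)\in E(F)}W(x_i,x_j)\prod d\mu(x_i)$ for all finite tournaments $F$. For $r\in(0,1)$ and tournament limits $\Gamma_1,\Gamma_2$, $r\Gamma_1\oplus(1-r)\Gamma_2$ is the unique tournament limit with $t_{\mathrm{ind}}(F,\cdot)=\sum r^{v(F_1)}(1-r)^{v(F_2)}t_{\mathrm{ind}}(F_1,\Gamma_1)t_{\mathrm{ind}}(F_2,\Gamma_2)$, the sum over ordered partitions of $V(F)$ into induced (possibly empty) subtournaments $F_1,F_2$ with all edges between them going from $F_1$ to $F_2$ (conventions $t_{\mathrm{ind}}(\emptyset,\cdot)=1$). $\Gamma$ is reducible if $\Gamma=r\Gamma_1\oplus(1-r)\Gamma_2$ for some $r\in(0,1)$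 and tournament limits $\Gamma_1,\Gamma_2$; otherwise irreducible. $G(\infty,W)$: draw $X_1,X_2,\dots$ i.i.d. from $\mu$ and, independently for each $i<j$ in $\mathbb N$, put the edge $(i,j)$ with probability $W(X_i,X_j)$ and otherwise $(j,i)$. A countable tournament is reducible if its vertex set splits into two nonempty parts with all edges between them going from the first to the second; otherwise irreducible. *)

(* Defs.v *)
From HB Require Import structures.
From mathcomp Require Import all_boot all_order all_algebra.
From mathcomp Require Import all_classical all_reals all_analysis.

Set Implicit Arguments.
Unset Strict Implicit.
Unset Printing Implicit Defensive.

Import Order.TTheory GRing.Theory Num.Theory.
Import numFieldNormedType.Exports.

Local Open Scope classical_set_scope.
Local Open Scope ring_scope.

Definition is_tournament (V : eqType) (e : rel V) : Prop :=
  irreflexive e /\ (forall x y, x != y -> e x y = ~~ e y x).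

Record tournament (V : eqType) := Tournament {
  edge :> rel V;
  edgeP : is_tournament edge }.

Lemma induced_subproof (U V : eqType) (G : tournament V) (f : U -> V) :
  injective f -> is_tournament (fun i j => G (f i) (f j)).
Proof.
case: G => e [eI eN] f_inj; split=> [i|i j ij] /=; first exact: eI.
by apply: eN; apply: contra ij => /eqP/f_inj ->.
Qed.

Definition induced (U V : eqType) (G : tournament V) (f : U -> V)
  (f_inj : injective f) : tournament U := Tournament (induced_subproof G f_inj).

(* The subtournament of F induced by A, its vertices renamed 0, ..., #|A| - 1. *)
Definition subtournament (k : nat) (F : tournament 'I_k) (A : {set 'I_k}) :
  tournament 'I_#|A| := induced F (@enum_val_inj _ (mem A)).

Definition reducible_tournament (V : eqType) (G : tournament V) : Prop :=
  exists A : set V,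
    [/\ A !=set0, (~` A) !=set0 & forall x y, A x -> ~ A y -> G x y].

Definition irreducible_tournament (V : eqType) (G : tournament V) : Prop :=
  ~ reducible_tournament G.

Definition ind_count (k n : nat) (F : tournament 'I_k) (G : tournament 'I_n) :
    nat :=
  #|[pred f : {ffun 'I_k -> 'I_n} | injectiveb f &&
     [forall i, forall j, G (f i) (f j) == F i j]]|.

Definition ind_density (R : realType) (k n : nat) (F : tournament 'I_k)
    (G : tournament 'I_n) : R := (ind_count F G)%:R / (n ^_ k)%:R.

Definition hom_count (k n : nat) (F : rel 'I_k) (G : tournament 'I_n) : nat :=
  #|[pred f : {ffun 'I_k -> 'I_n} |
     [forall i, forall j, F i j ==> G (f i) (f j)]]|.

Definition hom_density (R : realType) (k n : nat) (F : rel 'I_k)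
    (G : tournament 'I_n) : R := (hom_count F G)%:R / (n ^ k)%:R.

(* The test graphs of the second clause are all finite digraphs; those with a
   loop or a 2-cycle have homomorphism density 0 in every tournament. *)
Definition is_tournament_limit (R : realType)
    (t : forall k, tournament 'I_k -> R) : Prop :=
  exists (v : nat -> nat) (G : forall m, tournament 'I_(v m)),
    [/\ v m @[m --> \oo] --> \oo,
        forall k (F : rel 'I_k), cvgn (fun m => hom_density R F (G m))
      & forall k (F : tournament 'I_k),
          ind_density R F (G m) @[m --> \oo] --> t k F].

(* A tournament limit is determined by, and identified with, the family of its
   induced densities. *)
Record tournament_limit (R : realType) := TournamentLimit {
  t_ind : forall k, tournament 'I_k -> R;
  t_indP : is_tournament_limit t_ind }.
Arguments t_ind {R} _ {k} _.

(* The sum ranges over the A such that all edges between A and its complement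
   go from A to the complement: F_1 = F[A] and F_2 = F[~: A]. *)
Definition oplus_density (R : realType) (r : R)
    (Gamma1 Gamma2 : tournament_limit R) (k : nat) (F : tournament 'I_k) : R :=
  \sum_(A : {set 'I_k} | [forall i in A, forall j in ~: A, F i j])
     r ^+ #|A| * (1 - r) ^+ #|~: A| *
     t_ind Gamma1 (subtournament F A) * t_ind Gamma2 (subtournament F (~: A)).

(* Gamma = r Gamma1 (+) (1 - r) Gamma2 *)
Definition is_oplus (R : realType) (r : R)
    (Gamma1 Gamma2 Gamma : tournament_limit R) : Prop :=
  forall k (F : tournament 'I_k),
    t_ind Gamma F = oplus_density r Gamma1 Gamma2 F.

Definition reducible_limit (R : realType) (Gamma : tournament_limit R) : Prop :=
  exists (r : R) (Gamma1 Gamma2 : tournament_limit R),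
    0 < r < 1 /\ is_oplus r Gamma1 Gamma2 Gamma.

Definition irreducible_limit (R : realType) (Gamma : tournament_limit R) :
  Prop := ~ reducible_limit Gamma.

Section power_measure.
Context {R : realType} {d : measure_display} {S : measurableType d}.

Definition cons_tuple (n : nat) (z : S * n.-tuple S) : n.+1.-tuple S :=
  [tuple of z.1 :: z.2].

Lemma measurable_cons_tuple n : measurable_fun setT (@cons_tuple n).
Proof. exact: measurable_cons. Qed.

HB.instance Definition _ n :=
  @isMeasurableFun.Build _ _ _ _ (@cons_tuple n) (@measurable_cons_tuple n).

Fixpoint power_measure (mu : probability S R) (n : nat) :
    probability (n.-tuple S) R :=
  match n with
  | 0 => dirac [tuple]
  | n'.+1 => distribution (mu \x power_measure mu n')%E (@cons_tuple n')
  end.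

End power_measure.

Section kernels.
Context {R : realType} {d : measure_display} {S : measurableType d}.
Variables (mu : probability S R) (W : S * S -> R).

Definition tournament_kernel : Prop :=
  [/\ measurable_fun setT W,
      forall z, 0 <= W z <= 1
    & {ae (mu \x mu)%E, forall z, W (z.1, z.2) + W (z.2, z.1) = 1}].

Definition reducible_kernel : Prop :=
  exists B : set S,
    [/\ measurable B, (0 < mu B < 1)%E
      & {ae (mu \x mu)%E, forall z, (B `*` ~` B) z -> W z = 1}].

Definition irreducible_kernel : Prop := ~ reducible_kernel.

Definition represents (Gamma : tournament_limit R) : Prop :=
  forall k (F : tournament 'I_k),
    (t_ind Gamma F)%:E =
    (\int[power_measure mu k]_x
       (\prod_(p : 'I_k * 'I_k | F p.1 p.2) W (tnth x p.1, tnth x p.2))%:E)%E.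

(* (X, G) is a realization, on the probability space (Omega, P), of the types
   and of the edges of G(oo, W): the last clause says that X_0, ..., X_(n-1)
   are i.i.d. with law mu and that, given them, the edges inside {0, ..., n-1}
   are independent, i -> j (for i < j) having probability W(X_i, X_j). *)
Definition is_G_infty (d' : measure_display) (Omega : measurableType d')
    (P : probability Omega R) (X : nat -> Omega -> S)
    (G : Omega -> tournament nat) : Prop :=
  [/\ forall i, measurable_fun setT (X i),
      forall i j, measurable [set omega | G omega i j]
    & forall n (F : tournament 'I_n) (A : 'I_n -> set S),
        (forall i, measurable (A i)) ->
        P [set omega | (forall i : 'I_n, A i (X i omega)) /\
                       (forall i j : 'I_n, G omega i j = F i j)] =
        (\int[power_measure mu n]_(x in [set x | forall i, A i (tnth x i)])
           (\prod_(p : 'I_n * 'I_n | (p.1 < p.2)%N)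
              (if F p.1 p.2 then W (tnth x p.1, tnth x p.2)
               else 1 - W (tnth x p.1, tnth x p.2)))%:E)%E].

(* Being almost surely irreducible depends only on the law of G(oo, W), so it
   is required of every realization. *)
Definition G_infty_as_irreducible : Prop :=
  forall (d' : measure_display) (Omega : measurableType d')
    (P : probability Omega R) (X : nat -> Omega -> S)
    (G : Omega -> tournament nat),
    is_G_infty P X G ->
    {ae P, forall omega, irreducible_tournament (G omega)}.

End kernels.

(* Main.v *)
(** Replacing [W] by [(W + 1 - W^T) / 2], which equals [W] almost everywhere, we
    may assume that [W x y + W y x = 1] everywhere.

    If [W] is reducible, witnessed by [B], then conditioning [mu] on [B] and on
    its complement splits every integral defining [t_ind F Gamma] along the
    subsets of [V(F)]; the two conditioned kernels represent tournament limits
    because the random tournament [G(n, W)] has the right mean densities with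
    variance [O(1/n)].

    If [Gamma = r Gamma1 (+) (1 - r) Gamma2], then for every [n] the restriction
    of [G(oo, W)] to [n] vertices has, with probability at least [r (1 - r)], a
    splitting with vertex 0 in the first part and vertex 1 in the second.  Hence
    with positive probability 1 does not reach 0 in [G(oo, W)], and the set of
    vertices reaching 0 witnesses reducibility.  This requires one realization
    of [G(oo, W)], which is built on a countably infinite product space.

    If [W] is irreducible, the set of points having a chain of positive density
    to [y] is closed under predecessors, so it has measure 0 or 1, and the value
    0 is excluded for almost every [y].  So for [i <> j] there is almost surely
    a [k] such that [k] fresh vertices form a path from [i] to [j] with positive
    conditional probability; infinitely many disjoint attempts make [i] reach
    [j] almost surely. *)

Require Import Defs.
From HB Require Import structures.
From mathcomp Require Import all_boot all_order all_algebra.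
From mathcomp Require Import all_classical all_reals all_analysis.
From mathcomp Require Import measurable_realfun lra zify.

Set Implicit Arguments.
Unset Strict Implicit.
Unset Printing Implicit Defensive.

Import Order.TTheory GRing.Theory Num.Theory.
Import numFieldNormedType.Exports.

Local Open Scope classical_set_scope.
Local Open Scope ring_scope.

(** * Finite tournaments *)

(** The pointwise identity [W (x, y) + W (y, x) = 1] makes [weight] a probability on finite
    tournaments for every sample of types, not only for almost every one, so that a single summation
    lemma yields all marginals; this is what antisymmetrization buys. The implications form the
    cycle (a), (b), (c), (a). A tournament limit must come with finite tournaments converging to it.
    The second-moment bound yields one good tournament for each accuracy, so no almost sure
    convergence has to be proved there. Since [S] carries no topology, compactness cannot give the
    countable additivity of the infinite product; coordinates are fixed one at a time instead.
    Statement (c) concerns every realization, so (b) to (c) works only with the law of finite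
    restrictions. In (c) to (a), the splittings found for different [n] need not be compatible; what
    survives in the limit is that 1 does not reach 0. In (b) to (c), the length of a good path
    depends on the random types, so the attempts run through all lengths, each of them many
    times. *)

Lemma tournament_ext (V : eqType) (G H : tournament V) :
  (forall x y, G x y = H x y) -> G = H.
Proof.
case: G H => [e eP] [e' e'P] /= ee'.
have {}ee' : e = e' by apply/funext => x; apply/funext => y; exact: ee'.
by subst e'; congr Tournament; exact: Prop_irrelevance.
Qed.

Lemma tournament_irr (V : eqType) (G : tournament V) x : G x x = false.
Proof. by case: G => e [eI eN]; exact: eI. Qed.

Lemma tournament_anti (V : eqType) (G : tournament V) x y :
  x != y -> G x y = ~~ G y x.
Proof. by case: G => e [eI eN] /=; exact: eN. Qed.

Section tournament_finite.
Variable n : nat.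
Implicit Types (G H : tournament 'I_n) (E : {set 'I_n * 'I_n}).

(** The injection into finite sets of pairs makes [tournament 'I_n] a finite type, so that sums over
    all tournaments on [n] vertices make sense. *)
Definition edge_set G : {set 'I_n * 'I_n} := [set p | G p.1 p.2].

Definition tournament_of_set E : option (tournament 'I_n) :=
  if pselect (is_tournament (fun x y => (x, y) \in E)) is left P
  then Some (Tournament P) else None.

Lemma edge_setK : pcancel edge_set tournament_of_set.
Proof.
move=> G; rewrite /tournament_of_set; case: pselect => [P|[]].
  by congr Some; apply: tournament_ext => x y /=; rewrite inE.
case: G => e [eI eN]; split => [x|x y xy] /=; rewrite !inE /=; first exact: eI.
exact: eN.
Qed.

HB.instance Definition _ := Finite.copy (tournament 'I_n) (pcan_type edge_setK).

End tournament_finite.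

(** * Edge events in a random tournament with independent edges *)

Section extensions.
Variables (R : numDomainType) (n : nat) (w : 'I_n -> 'I_n -> R).
Hypothesis w_anti : forall i j, i != j -> w i j + w j i = 1.
Implicit Types (E : {set 'I_n * 'I_n}) (H : tournament 'I_n).

(** If [w i j] is the probability of the edge from [i] to [j], independently for each pair, this is
    the probability of obtaining [H]. *)
Definition weight H : R := \prod_(p : 'I_n * 'I_n | H p.1 p.2) w p.1 p.2.

(** Induction on the number of pairs outside [E]. An undecided pair is oriented one way or the
    other, and the two weights [w i j] and [w j i] sum to 1. If no pair is undecided, [E] is itself
    a tournament and the sum has one term. *)
Lemma sum_extensions E : {in E, forall p, (p.2, p.1) \notin E} ->
  \sum_(H | E \subset edge_set H) weight H = \prod_(p in E) w p.1 p.2.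
Proof.
have [c] := ubnP #|~: E|; elim: c E => // c IH E cE Eanti.
have [/existsP[[i j] /= /and3P[ij Eij Eji]]|Etot] :=
  boolP [exists p : 'I_n * 'I_n,
    [&& p.1 != p.2, p \notin E & (p.2, p.1) \notin E]].
  have step a b : a != b -> (a, b) \notin E -> (b, a) \notin E ->
      \sum_(H | (a, b) |: E \subset edge_set H) weight H =
      w a b * \prod_(p in E) w p.1 p.2.
    move=> ab Eab Eba; rewrite IH ?big_setU1//=.
      rewrite -ltnS (leq_trans _ cE)// ltnS proper_card//.
      by rewrite properC properUr// finset.sub1set.
    move=> p; rewrite !inE => /orP[/eqP->/=|pE].
      by rewrite xpair_eqE negb_or eq_sym (negbTE ab).
    rewrite negb_or Eanti// andbT; apply: contra Eba => /eqP[<- <-].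
    by rewrite -surjective_pairing.
  rewrite (bigID (fun H => (i, j) \in edge_set H))/=.
  have -> : \prod_(p in E) w p.1 p.2 =
      w i j * (\prod_(p in E) w p.1 p.2) + w j i * \prod_(p in E) w p.1 p.2.
    by rewrite -mulrDl w_anti// mul1r.
  rewrite -!step// 1?eq_sym//.
  congr (_ + _); apply: eq_bigl => H; rewrite finset.subUset finset.sub1set andbC//.
  by congr (_ && _); rewrite !inE /= tournament_anti// negbK.
have EP : is_tournament (fun x y => (x, y) \in E).
  split=> [x|x y xy].
    by apply/negP => xx; have := Eanti _ xx; rewrite xx.
  apply/idP/idP => [/Eanti//|yx]; apply/negPn/negP => xyE.
  by move/negP: Etot; apply; apply/existsP; exists (x, y); rewrite xy xyE.
rewrite (big_pred1 (Tournament EP)); last first.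
  move=> H; apply/idP/eqP => [/fintype.subsetP sEH|->]; last first.
    by apply/fintype.subsetP => -[x y]; rewrite inE.
  apply: tournament_ext => x y /=.
  have [->|xy] := eqVneq x y; first by rewrite tournament_irr (EP.1 y).
  apply/idP/idP => [Hxy|/sEH]; last by rewrite inE.
  rewrite (EP.2 _ _ xy); apply/negP => /sEH; rewrite inE /=.
  by rewrite tournament_anti 1?eq_sym// Hxy.
by rewrite /weight; apply: eq_bigl => -[x y].
Qed.

(** The edges of [E] are forced, and each list in [Es] must miss at least one of its edges; the
    probabilities multiply because no unordered pair occurs twice. The induction step removes a list
    [e] by subtracting the case where [e] is forced too. This gives the independence of the attempts
    to join two vertices by disjoint paths. *)
Lemma sum_extensions_avoid (E : seq ('I_n * 'I_n)) (Es : seq (seq ('I_n * 'I_n))) :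
  uniq (E ++ flatten Es) ->
  {in E ++ flatten Es, forall p, (p.2, p.1) \notin E ++ flatten Es} ->
  \sum_(H : tournament 'I_n | all (fun p => H p.1 p.2) E &&
            all (fun e => ~~ all (fun p => H p.1 p.2) e) Es) weight H =
  (\prod_(p <- E) w p.1 p.2) * \prod_(e <- Es) (1 - \prod_(p <- e) w p.1 p.2).
Proof.
elim: Es E => [|e Es IH] E /=.
  rewrite cats0 big_nil mulr1 => uE Eanti.
  rewrite big_uniq//=.
  transitivity (\prod_(p in [set p in E]) w p.1 p.2); last first.
    by apply: eq_bigl => p; rewrite inE.
  rewrite -sum_extensions; last by move=> p; rewrite !inE; exact: Eanti.
  apply: eq_bigl => H; rewrite andbT; apply/allP/fintype.subsetP => h p; have := h p;
    by rewrite !inE.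
move=> uE Eanti; rewrite big_cons mulrA mulrBr mulr1 -big_cat/= mulrBl.
have uE2 := uE; rewrite catA in uE2; rewrite -(IH (E ++ e))//; last first.
  by rewrite -catA.
have sE : {subset E ++ flatten Es <= E ++ e ++ flatten Es}.
  by move=> p; rewrite !mem_cat => /orP[] ->; rewrite ?orbT.
rewrite -IH; last 2 first.
- by apply: subseq_uniq uE; rewrite cat_subseq// suffix_subseq// suffix_suffix.
- by move=> p /sE /Eanti; apply: contra => /sE.
rewrite [in RHS](bigID (fun H : tournament 'I_n =>
  all (fun p => H p.1 p.2) e))/= addrC -addrA.
rewrite [X in _ = _ + X](_ : _ = 0) ?addr0.
  by apply: eq_bigl => H; rewrite -andbA; congr (_ && _); rewrite andbC.
apply/eqP; rewrite subr_eq0; apply/eqP; apply: eq_bigl => H.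
by rewrite all_cat -!andbA; congr (_ && _); rewrite andbC.
Qed.

Lemma sum_weight : \sum_H weight H = 1.
Proof.
have := @sum_extensions_avoid [::] [::] isT.
by rewrite !big_nil mulr1 => <-//.
Qed.

End extensions.

(** * Sampling finite tournaments *)

Section embeddings.
Variables k n : nat.
Implicit Types (F : tournament 'I_k) (H : tournament 'I_n).
Implicit Type f : {ffun 'I_k -> 'I_n}.

Definition embeds F H f := [forall i, forall j, H (f i) (f j) == F i j].

Lemma embeds_inj F H f : embeds F H f -> injective f.
Proof.
move=> /forallP fP i j fij; apply/eqP/negPn/negP => ij.
have /forallP/(_ j)/eqP := fP i; have /forallP/(_ i)/eqP := fP j.
by rewrite fij tournament_irr (tournament_anti F ij) => <-.
Qed.

Lemma embeds_induced H f F (f_inj : injective f) :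
  embeds F H f = (F == Defs.induced H f_inj).
Proof.
apply/idP/eqP => [/forallP fP|->].
  by apply: tournament_ext => i j; have /forallP/(_ j)/eqP := fP i.
by apply/forallP => i; apply/forallP => j.
Qed.

Lemma ind_countE F H : ind_count F H = #|[pred f | embeds F H f]|.
Proof.
apply: eq_card => f; rewrite !inE; apply/idP/idP => [/andP[]//|fP].
by rewrite [X in _ && X]fP andbT; apply/injectiveP/(embeds_inj fP).
Qed.

Lemma ind_countR (R : numDomainType) F H :
  (ind_count F H)%:R = \sum_f (embeds F H f)%:R :> R.
Proof.
rewrite ind_countE -sum1_card natr_sum big_mkcond/=; apply: eq_bigr => f _.
by rewrite inE; case: ifP.
Qed.

End embeddings.

(** A map from [m] points to [n] points fails to be injective only if two of them collide, and
    fixing a colliding pair leaves at most [n ^ (m - 1)] maps. The factor [n] keeps the estimate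
    inside the natural numbers. *)
Lemma expn_leq_ffact n m : (n * n ^ m <= n * n ^_ m + m ^ 2 * n ^ m)%N.
Proof.
elim: m => [|m IH]; first by rewrite expn0 ffactn0 muln1 mul0n addn0.
rewrite ffactnSr expnS.
have ffle : (n ^_ m <= n ^ m)%N.
  elim: {IH} m => // m IH; by rewrite ffactnSr expnSr leq_mul// leq_subr//.
move: (n ^_ m) (n ^ m)%N ffle IH => a b ab IH.
have h1 : (n * (n * b) <= n * (n * a + m ^ 2 * b))%N by rewrite leq_mul2l IH orbT.
apply: leq_trans h1 _.
have h2 : (n * (n * a) <= n * (a * (n - m)) + m * (n * b))%N.
  have h3 : (n * a <= a * (n - m) + m * b)%N.
    (* The subtraction is truncated; [n - m + m] is at least [n] even when [m] exceeds [n]. *)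
    apply: (@leq_trans ((n - m + m) * a)); first by rewrite leq_mul2r; lia.
    by rewrite mulnDl mulnC leq_add2l leq_mul2l ab orbT.
  apply: (@leq_trans (n * (a * (n - m) + m * b))%N); first by rewrite leq_mul2l h3 orbT.
  nia.
nia.
Qed.

Section sampling.
Variables (R : realType) (p : forall n, tournament 'I_n -> R).
Hypothesis p_ge0 : forall n (H : tournament 'I_n), 0 <= p H.
Hypothesis p_sum : forall n, \sum_(H : tournament 'I_n) p H = 1.
Hypothesis p_sub : forall k n (F : tournament 'I_k) (f : {ffun 'I_k -> 'I_n}),
  injective f -> \sum_(H | embeds F H f) p H = p F.
Hypothesis p_indep : forall k n (F : tournament 'I_k)
    (f : {ffun 'I_(k + k) -> 'I_n}), injective f ->
  \sum_(H | embeds F H [ffun i => f (lshift k i)] &&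
            embeds F H [ffun i => f (rshift k i)]) p H = p F ^+ 2.

Lemma p_le1 n (H : tournament 'I_n) : p H <= 1.
Proof. by rewrite -(p_sum n) (bigD1 H)//= lerDl sumr_ge0. Qed.

Lemma mean_ind_count k n (F : tournament 'I_k) :
  \sum_(H : tournament 'I_n) p H * (ind_count F H)%:R = (n ^_ k)%:R * p F.
Proof.
under eq_bigr do rewrite ind_countR mulr_sumr.
rewrite exchange_big/=.
transitivity (\sum_(f : {ffun 'I_k -> 'I_n} | injectiveb f) p F).
  rewrite [RHS]big_mkcond; apply: eq_bigr => f _; case: ifPn => [/injectiveP fi|fi].
    rewrite -(p_sub F fi) [RHS]big_mkcond; apply: eq_bigr => H _.
    by case: ifP; rewrite ?mulr1 ?mulr0.
  apply: big1 => H _; have [/embeds_inj/injectiveP|] := boolP (embeds _ _ _).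
    by rewrite (negbTE fi).
  by rewrite mulr0.
rewrite sumr_const mulr_natl; congr (_ *+ _).
have := card_inj_ffuns 'I_k 'I_n; rewrite !card_ord => <-.
by apply: eq_card => f; rewrite inE.
Qed.

Lemma sum_ffun_add k l n (a : {ffun 'I_k -> 'I_n} -> {ffun 'I_l -> 'I_n} -> R) :
  \sum_f \sum_g a f g = \sum_(h : {ffun 'I_(k + l) -> 'I_n})
    a [ffun i => h (lshift l i)] [ffun i => h (rshift k i)].
Proof.
rewrite pair_big/=.
pose u (h : {ffun 'I_(k + l) -> 'I_n}) :=
  ([ffun i => h (lshift l i)] : {ffun 'I_k -> 'I_n},
   [ffun i => h (rshift k i)] : {ffun 'I_l -> 'I_n}).
pose v (q : {ffun 'I_k -> 'I_n} * {ffun 'I_l -> 'I_n}) : {ffun 'I_(k + l) -> 'I_n} :=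
  [ffun i => match fintype.split i with inl i => q.1 i | inr i => q.2 i end].
rewrite (reindex u)//=; exists v => [h|[f g]] _; rewrite /u /v /=.
  apply/ffunP => i; rewrite ffunE -{2}(splitK i).
  by case: (fintype.split i) => j; rewrite ffunE.
by congr pair; apply/ffunP => i; rewrite !ffunE ?(unsplitK (inl _)) ?(unsplitK (inr _)).
Qed.

(** A pair of maps from [k] points is one map from [k + k] points. Injective ones contribute exactly
    [p F ^+ 2] by [p_indep], and each of the others at most 1. *)
Lemma mean_sqr_ind_count k n (F : tournament 'I_k) :
  \sum_(H : tournament 'I_n) p H * (ind_count F H)%:R ^+ 2 <=
  (n ^ (k + k))%:R * p F ^+ 2 + ((n ^ (k + k))%:R - (n ^_ (k + k))%:R).
Proof.
have -> : \sum_(H : tournament 'I_n) p H * (ind_count F H)%:R ^+ 2 =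
  \sum_(h : {ffun 'I_(k + k) -> 'I_n}) \sum_(H : tournament 'I_n |
     embeds F H [ffun i => h (lshift k i)] &&
     embeds F H [ffun i => h (rshift k i)]) p H.
  under eq_bigr.
    move=> H _; rewrite ind_countR expr2 mulr_suml.
    under eq_bigr do rewrite mulr_sumr.
    rewrite sum_ffun_add mulr_sumr; over.
  rewrite exchange_big/=; apply: eq_bigr => h _; rewrite [RHS]big_mkcond.
  apply: eq_bigr => H _.
  by do 2 case: (embeds _ _ _); rewrite /= ?mulr1 ?mulr0 ?mul0r.
have cardT : (n ^ (k + k))%:R = \sum_(h : {ffun 'I_(k + k) -> 'I_n}) 1 :> R.
  by rewrite sumr_const card_ffun !card_ord.
have cardI : (n ^_ (k + k))%:R =
    \sum_(h : {ffun 'I_(k + k) -> 'I_n}) (injectiveb h)%:R :> R.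
  have := card_inj_ffuns 'I_(k + k) 'I_n; rewrite !card_ord => <-.
  rewrite -sum1_card natr_sum big_mkcond; apply: eq_bigr => h _.
  by rewrite inE; case: ifP.
rewrite cardT cardI -sumrB mulr_suml -big_split/=; apply: ler_sum => h _.
have [/injectiveP hi|_] := boolP (injectiveb h).
  by rewrite p_indep// mul1r subrr addr0.
rewrite mul1r subr0 -[leLHS]add0r lerD ?exprn_ge0//.
by rewrite -(p_sum n) [leRHS](bigID (fun H => embeds F H [ffun i => h (lshift k i)] &&
     embeds F H [ffun i => h (rshift k i)]))/= lerDl sumr_ge0.
Qed.

(** Dividing by [n ^ k] instead of [n ^_ k] lets the second moment be compared with a plain square;
    the two normalizations agree in the limit. *)
Definition emb_density k n (F : tournament 'I_k) (H : tournament 'I_n) : R :=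
  (ind_count F H)%:R / (n ^ k)%:R.

Lemma ffact_ratio n m : (0 < n)%N ->
  1 - (m ^ 2)%:R / n%:R <= (n ^_ m)%:R / (n ^ m)%:R :> R.
Proof.
move=> n0; have n0R : 0 < n%:R :> R by rewrite ltr0n.
have nm0 : 0 < (n ^ m)%:R :> R by rewrite ltr0n expn_gt0 n0.
rewrite ler_pdivlMr// mulrBl mul1r lerBlDr mulrAC -(ler_pM2l n0R) mulrDr.
by rewrite (mulrC n%:R (_ / _)) divfK ?gt_eqF// -!natrM -natrD ler_nat expn_leq_ffact.
Qed.

Lemma ffact_ratio_le1 n m : (n ^_ m)%:R / (n ^ m)%:R <= 1 :> R.
Proof.
have [nm0|] := posnP (n ^ m); first by rewrite nm0 invr0 mulr0.
move=> nm0; rewrite ler_pdivrMr ?ltr0n// mul1r ler_nat.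
by elim: m {nm0} => // m IH; rewrite ffactnSr expnSr leq_mul// leq_subr//.
Qed.

(** This is the mean square distance to [p F], which is the mean of [emb_density] only up to the
    factor [n ^_ k / n ^ k]. Of the constant 6, the second moment accounts for [(k + k) ^ 2], that
    is 4, and the cross term for 2. *)
Lemma variance_emb_density k n (F : tournament 'I_k) : (0 < n)%N ->
  \sum_(H : tournament 'I_n) p H * (emb_density F H - p F) ^+ 2 <=
  (6 * k ^ 2)%:R / n%:R.
Proof.
move=> n0; have n0R : 0 < n%:R :> R by rewrite ltr0n.
have nk0 : 0 < (n ^ k)%:R :> R by rewrite ltr0n expn_gt0 n0.
set c : R := (n ^ k)%:R.
have -> : \sum_(H : tournament 'I_n) p H * (emb_density F H - p F) ^+ 2 =
    (\sum_(H : tournament 'I_n) p H * (ind_count F H)%:R ^+ 2) / c ^+ 2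
    - 2 * p F / c * (\sum_(H : tournament 'I_n) p H * (ind_count F H)%:R)
    + p F ^+ 2 * \sum_(H : tournament 'I_n) p H.
  rewrite mulr_suml !mulr_sumr -sumrB -big_split/=; apply: eq_bigr => H _.
  by rewrite /emb_density -/c -exprVn; lra.
rewrite mean_ind_count p_sum mulr1.
have h1 := @mean_sqr_ind_count k n F.
have c2 : (n ^ (k + k))%:R = c ^+ 2 by rewrite expnD natrM expr2.
have h2 := ffact_ratio k n0; rewrite -/c in h2.
have h3 := ffact_ratio (k + k) n0; rewrite c2 in h3.
have pF1 := p_le1 F; have pF0 := p_ge0 F.
have h4 : (\sum_(H : tournament 'I_n) p H * (ind_count F H)%:R ^+ 2) / c ^+ 2 <=
    p F ^+ 2 + ((k + k) ^ 2)%:R / n%:R.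
  rewrite ler_pdivrMr ?exprn_gt0//; apply: le_trans h1 _; rewrite c2.
  move: h3; rewrite ler_pdivlMr ?exprn_gt0//; lra.
have -> : 2 * p F / c * ((n ^_ k)%:R * p F) =
   2 * p F ^+ 2 * ((n ^_ k)%:R / c) by lra.
have pF2 : 0 <= p F ^+ 2 <= 1 by rewrite exprn_ge0//= exprn_ile1.
have -> : (6 * k ^ 2)%:R / n%:R = ((k + k) ^ 2)%:R / n%:R + 2 * ((k ^ 2)%:R / n%:R) :> R.
  rewrite mulrA -mulrDl; congr (_ / _).
  by rewrite -[2]/(2%:R) -natrM -natrD; congr (_%:R); nia.
have q0 : 0 <= (k ^ 2)%:R / n%:R :> R by rewrite divr_ge0.
move: ((k ^ 2)%:R / n%:R) ((n ^_ k)%:R / c) h2 h4 q0 => a b; nra.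
Qed.

(** The square errors of all [F] on at most [K] vertices are summed. Since the mean of this sum is
    small, some single tournament does as well as the mean, and it is then good for all these [F] at
    once. *)
Lemma exists_good_sample K : exists n (H : tournament 'I_n), (K < n)%N /\
  forall k (F : tournament 'I_k), (k <= K)%N ->
    (emb_density F H - p F) ^+ 2 <= K.+1%:R^-1.
Proof.
(* By the variance bound the mean of the total error is at most [C / n]; the choice of [n] makes
   this at most [1 / (K + 1)] and also gives [K < n]. *)
pose C := (\sum_(k < K.+1) \sum_(F : tournament 'I_k) 6 * k ^ 2)%N.
pose n := (C.+1 * K.+1)%N.
have n0 : (0 < n)%N by [].
pose s (H : tournament 'I_n) : R := \sum_(k < K.+1) \sum_(F : tournament 'I_k)
  (emb_density F H - p F) ^+ 2.
have ps : \sum_(H : tournament 'I_n) p H * s H <= K.+1%:R^-1.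
  under eq_bigr do rewrite mulr_sumr.
  rewrite exchange_big/=.
  apply: (@le_trans _ _ (C%:R / n%:R)); last first.
    rewrite /n natrM invfM mulrA ler_piMl ?invr_ge0//.
    by rewrite ler_pdivrMr ?ltr0n// mul1r ler_nat.
  rewrite /C natr_sum mulr_suml; apply: ler_sum => k _.
  under eq_bigr do rewrite mulr_sumr.
  rewrite exchange_big/= natr_sum mulr_suml; apply: ler_sum => F _.
  exact: variance_emb_density.
have [H sH] : exists H : tournament 'I_n, s H <= K.+1%:R^-1.
  apply/not_existsP => hs; have {}hs H : K.+1%:R^-1 < s H.
    by rewrite ltNge; apply/negP/hs.
  have [H pH] : exists H : tournament 'I_n, 0 < p H.
    apply/not_existsP => hp; have := p_sum n; rewrite big1 => [/eqP|H _].
      by rewrite eq_sym oner_eq0.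
    by apply/eqP; rewrite eq_le p_ge0 andbT leNgt; apply/negP/hp.
  suff : \sum_(H : tournament 'I_n) p H * K.+1%:R^-1 < K.+1%:R^-1.
    by rewrite -mulr_suml p_sum mul1r ltxx.
  apply: lt_le_trans ps; rewrite [ltLHS](bigD1 H)//= [ltRHS](bigD1 H)//=.
  apply: ltr_leD; first by rewrite ltr_pM2l.
  by apply: ler_sum => H' _; rewrite ler_wpM2l// ltW.
exists n, H; split; first by rewrite /n; nia.
move=> k F kK; apply: le_trans sH.
have kK' : (k < K.+1)%N by [].
rewrite /s (bigD1 (Ordinal kK'))//= (bigD1 F)//= -addrA lerDl.
rewrite addr_ge0// ?sumr_ge0// => *; rewrite ?sumr_ge0// => *; exact: sqr_ge0.
Qed.

End sampling.

(** An injective map pulls [G] back to exactly one tournament on ['I_k], and it is a homomorphism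
    from [F] iff that tournament contains the edges of [F]. *)
Lemma hom_count_inj k n (F : rel 'I_k) (G : tournament 'I_n) :
  #|[pred f : {ffun 'I_k -> 'I_n} | injectiveb f &&
     [forall i, forall j, F i j ==> G (f i) (f j)]]| =
  (\sum_(F' : tournament 'I_k | [forall i, forall j, F i j ==> F' i j])
     ind_count F' G)%N.
Proof.
rewrite -sum1_card [LHS]big_mkcond/=.
under [RHS]eq_bigr do rewrite ind_countE -sum1_card big_mkcond/=.
rewrite exchange_big/=; apply: eq_bigr => f _; rewrite inE.
have [/injectiveP fi/=|fi/=] := boolP (injectiveb f); last first.
  rewrite big1// => F' _; rewrite inE; case: ifP => // /embeds_inj/injectiveP.
  by rewrite (negbTE fi).
under eq_bigr do rewrite inE embeds_induced.
rewrite -big_mkcondr/=; case: ifP => fP.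
  rewrite (big_pred1 (Defs.induced G fi))// => F'.
  by rewrite /=; case: eqP => [->|_]; [rewrite andbT; exact: fP|rewrite andbF].
rewrite big_pred0// => F'.
by case: eqP => [->|_]; [rewrite andbT; exact: fP|rewrite andbF].
Qed.

(** The tournaments chosen for [K = 0, 1, 2, ...] form the converging sequence: each fixed [F] is
    covered from some index on, with error tending to 0. *)
Lemma limit_of_samples (R : realType) (p : forall n, tournament 'I_n -> R) :
  (forall K, exists n (H : tournament 'I_n), (K < n)%N /\
    forall k (F : tournament 'I_k), (k <= K)%N ->
      (emb_density R F H - p k F) ^+ 2 <= K.+1%:R^-1) ->
  is_tournament_limit p.
Proof.
move=> hgood.
pose v K := projT1 (cid (hgood K)).
pose G K : tournament 'I_(v K) := projT1 (cid (projT2 (cid (hgood K)))).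
have vK K : (K < v K)%N by case: (projT2 (cid (projT2 (cid (hgood K))))).
have GK K k (F : tournament 'I_k) : (k <= K)%N ->
    (emb_density R F (G K) - p k F) ^+ 2 <= K.+1%:R^-1.
  by move=> kK; case: (projT2 (cid (projT2 (cid (hgood K))))) => _; exact.
have vR K : K.+1%:R <= (v K)%:R :> R by rewrite ler_nat.
have v0 K : 0 < (v K)%:R :> R by apply: lt_le_trans (vR K); rewrite ltr0n.
have emb_cvg k (F : tournament 'I_k) :
    emb_density R F (G m) @[m --> \oo] --> p k F.
  apply/cvgrPdist_le => e e0; near=> m.
  have xe : (emb_density R F (G m) - p k F) ^+ 2 <= e ^+ 2.
    apply: le_trans (GK m k F _) _; first by near: m; exact: nbhs_infty_ge.
    near: m; have e20 : 0 < e ^+ 2 by rewrite exprn_gt0.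
    have := near_infty_natSinv_lt (PosNum e20).
    by apply: filterS => m /= /ltW.
  by rewrite distrC ler_norml; apply/andP; split; nra.
have ratio_cvg k : (v m ^_ k)%:R / (v m ^ k)%:R @[m --> \oo] --> (1 : R).
  apply: (@squeeze_cvgr _ _ _ _ (fun m => 1 - (k ^ 2)%:R * m.+1%:R^-1) (fun=> 1)).
  - near=> m; rewrite ffact_ratio_le1 andbT.
    apply: le_trans (@ffact_ratio R (v m) k _); last by rewrite (leq_trans _ (vK m)).
    by rewrite lerD2l lerN2 ler_wpM2l// lef_pV2 ?posrE// ltr0n.
  - rewrite -[X in _ --> X]subr0 -[X in _ - X](mulr0 (k ^ 2)%:R).
    apply: cvgB; first exact: cvg_cst.
    by apply: cvgM; [exact: cvg_cst|exact: cvg_harmonic].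
  - exact: cvg_cst.
exists v, G; split.
- apply/cvgnyPge => A; near=> m; rewrite ltnW// (leq_trans _ (vK m))// ltnS.
  by near: m; exact: nbhs_infty_ge.
- move=> k F; apply/cvg_ex.
  exists (\sum_(F' : tournament 'I_k | [forall i, forall j, F i j ==> F' i j]) p k F').
  (* Injective homomorphisms are counted by the finite sum over [F']; the remaining ones are at most
     all noninjective maps, whose proportion tends to 0. *)
  apply: (@squeeze_cvgr _ _ _ _
    (fun m => \sum_(F' : tournament 'I_k | [forall i, forall j, F i j ==> F' i j])
      emb_density R F' (G m))
    (fun m => (\sum_(F' : tournament 'I_k | [forall i, forall j, F i j ==> F' i j])
      emb_density R F' (G m)) + (1 - (v m ^_ k)%:R / (v m ^ k)%:R))).
  + near=> m.
    have vk0 : 0 < (v m ^ k)%:R :> R by rewrite natrX exprn_gt0.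
    have sumE : \sum_(F' : tournament 'I_k | [forall i, forall j, F i j ==> F' i j])
        emb_density R F' (G m) = #|[pred f : {ffun 'I_k -> 'I_(v m)} | injectiveb f &&
       [forall i, forall j, F i j ==> G m (f i) (f j)]]|%:R / (v m ^ k)%:R.
      by rewrite hom_count_inj natr_sum mulr_suml.
    rewrite sumE /hom_density.
    rewrite -[X in _ + (X - _)](divff (lt0r_neq0 vk0)) -mulrBl -mulrDl.
    rewrite !ler_pM2r ?invr_gt0// ler_nat subset_leq_card/=; last first.
      by apply/fintype.subsetP => f; rewrite !inE => /andP[].
    rewrite addrA lerBrDr -!natrD ler_nat.
    have := card_inj_ffuns 'I_k 'I_(v m); rewrite !card_ord => <-.
    have <- : #|{ffun 'I_k -> 'I_(v m)}| = (v m ^ k)%N by rewrite card_ffun !card_ord.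
    rewrite /hom_count -cardUI addnC leq_add//.
      by apply/subset_leq_card/fintype.subsetP => f; rewrite !inE andbC.
    exact: max_card.
  + by apply: cvg_big => [|F' _]; [exact: add_continuous|exact: emb_cvg].
  + rewrite -[X in _ --> X]addr0; apply: cvgD.
      by apply: cvg_big => [|F' _]; [exact: add_continuous|exact: emb_cvg].
    by rewrite -(subrr 1); apply: cvgB => //; exact: cvg_cst.
- move=> k F; rewrite -[X in _ --> X]divr1.
  have -> : (fun m => ind_density R F (G m)) =
    (fun m => emb_density R F (G m) / ((v m ^_ k)%:R / (v m ^ k)%:R)).
    apply/funext => m; have vk0 : (v m ^ k)%:R != 0 :> R.
      by rewrite gt_eqF// natrX exprn_gt0.
    by rewrite /emb_density invf_div mulrA divfK.
  by apply: cvgM => //; apply: cvgV => //; exact: oner_neq0.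
Unshelve. all: by end_near. Qed.

(** * Powers of a probability measure *)

Section power_measure_theory.
Context {R : realType} {d : measure_display} {S : measurableType d}.
Implicit Type mu : probability S R.

Definition box n (A : 'I_n -> set S) : set (n.-tuple S) :=
  [set x | forall i, A i (tnth x i)].

Lemma measurable_box n (A : 'I_n -> set S) :
  (forall i, measurable (A i)) -> measurable (box A).
Proof.
move=> mA; rewrite (_ : box A = \bigcap_(i in setT) ((@tnth n S)^~ i @^-1` A i)).
  apply: fin_bigcap_measurable => // i _.
  by rewrite -[X in measurable X]setTI; exact: measurable_tnth.
by apply/seteqP; split => [x xA i _|x xA i]; [exact: xA|exact: (xA i)].
Qed.

Lemma power_measure_box mu n (A : 'I_n -> set S) :
  (forall i, measurable (A i)) ->
  power_measure mu n (box A) = (\prod_(i < n) fine (mu (A i)))%:E.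
Proof.
elim: n A => [|n IH] A mA /=.
  rewrite big_ord0 diracE; rewrite (_ : _ \in _ = true)//.
  by apply/mem_set => -[].
rewrite /distribution /pushforward/=.
have -> : @Defs.cons_tuple _ S n @^-1` box A =
    A ord0 `*` box (fun i => A (lift ord0 i)).
  apply/seteqP; split => [[x t] /= h|[x t] /= [h0 h] i].
    by split => [|i]; [have := h ord0|have := h (lift ord0 i); rewrite tnthS].
  case: (unliftP ord0 i) => [j ->|->]//=.
  by rewrite tnthS; exact: h.
rewrite product_measure1E//; last exact: measurable_box.
rewrite big_ord_recl EFinM fineK ?fin_num_measure//.
by congr (_ * _)%E; apply: IH.
Qed.

Lemma measurable_tupleE n :
  @measurable _ (n.-tuple S) =
  <<s [set B | exists2 A : 'I_n -> set S, (forall i, measurable (A i)) & B = box A] >>.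
Proof.
apply/seteqP; split.
  apply: smallest_sub; first exact: smallest_sigma_algebra.
  rewrite -bigcup_seq => B [i _ [C mC <-]].
  apply: sub_sigma_algebra; exists (fun j => if j == i then C else setT).
    by move=> j; case: ifP.
  rewrite setTI; apply/seteqP; split => [x Cx j|x /(_ i)/=]; last by rewrite eqxx.
  by case: eqP => [->|].
apply: smallest_sub; first exact: sigma_algebra_measurable.
by move=> _ [A mA ->]; exact: measurable_box.
Qed.

(** Boxes are stable under intersection and generate the product sigma-algebra. *)
Lemma tuple_measure_unique n (P Q : probability (n.-tuple S) R) :
  (forall A : 'I_n -> set S, (forall i, measurable (A i)) ->
    P (box A) = Q (box A)) ->
  forall B, measurable B -> P B = Q B.
Proof.
move=> PQ B mB.
have boxT : box (fun _ : 'I_n => [set: S]) = setT by apply/seteqP; split.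
apply: (measure_unique [set B | exists2 A : 'I_n -> set S,
    (forall i, measurable (A i)) & B = box A] (fun=> setT)) => //.
- exact: measurable_tupleE.
- move=> _ _ [A mA ->] [A' mA' ->]; exists (fun i => A i `&` A' i).
    by move=> i; exact: measurableI.
  by apply/seteqP; split => [x [xA xA'] i|x xA]; [split|split=> i; case: (xA i)].
- by move=> _; exists (fun=> setT).
- by apply/seteqP; split => // x _; exists 0%N.
- by move=> _ [A mA ->]; exact: PQ.
- by move=> _; rewrite -ge0_fin_numE ?fin_num_measure//.
Qed.

Lemma integral_power_measureS mu n (f : n.+1.-tuple S -> \bar R) :
  measurable_fun [set: n.+1.-tuple S] f -> (forall x, 0 <= f x)%E ->
  (\int[power_measure mu n.+1]_x f x =
   \int[mu]_x \int[power_measure mu n]_t f (Defs.cons_tuple (x, t)))%E.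
Proof.
move=> mf f0 /=; rewrite ge0_integral_distribution//.
rewrite fubini_tonelli1//; first exact: measurableT_comp.
by move=> x; exact: f0.
Qed.

Definition reindex_tuple k n (f : 'I_k -> 'I_n) (x : n.-tuple S) : k.-tuple S :=
  [tuple tnth x (f i) | i < k].

Lemma measurable_reindex_tuple k n (f : 'I_k -> 'I_n) :
  measurable_fun setT (reindex_tuple f).
Proof.
apply/measurable_fun_tnthP => i.
rewrite (_ : _ \o _ = (fun x => tnth x (f i))); first exact: measurable_tnth.
by apply/funext => x /=; rewrite tnth_mktuple.
Qed.

HB.instance Definition _ k n (f : 'I_k -> 'I_n) :=
  @isMeasurableFun.Build _ _ _ _ (reindex_tuple f) (measurable_reindex_tuple f).

Lemma power_measure_reindex mu k n (f : 'I_k -> 'I_n) (B : set (k.-tuple S)) :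
  injective f -> measurable B ->
  distribution (power_measure mu n) (reindex_tuple f) B = power_measure mu k B.
Proof.
move=> fi mB; apply: (@tuple_measure_unique k
  (distribution (power_measure mu n) (reindex_tuple f)) (power_measure mu k)) => //.
move=> A mA; rewrite power_measure_box//= /distribution /pushforward.
(* At [f i] this is [A i]; outside the image of [f] the condition is vacuous and gives the whole
   space, of mass 1. *)
pose A' j := [set y | forall i, f i = j -> A i y].
have A'f i : A' (f i) = A i.
  by apply/seteqP; split => [y /(_ i erefl)//|y Ay j /fi ->].
have A'N j : j \notin codom f -> A' j = setT.
  move=> jf; apply/seteqP; split => // y _ i fij.
  by exfalso; move/negP: jf; apply; rewrite -fij codom_f.
have mA' j : measurable (A' j).
  have [/codomP[i ->]|/A'N ->//] := boolP (j \in codom f).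
  by rewrite A'f.
rewrite (_ : _ @^-1` _ = box A'); last first.
  apply/seteqP; split => [x/= h j i <-|x h i]; last by rewrite tnth_mktuple; exact: h.
  by have := h i; rewrite tnth_mktuple.
rewrite power_measure_box//; congr EFin.
rewrite (bigID (fun j => j \in codom f))/= [X in _ * X]big1 ?mulr1; last first.
  by move=> j /A'N ->; rewrite probability_setT.
rewrite -big_uniq; last by rewrite /codom/image_mem map_inj_uniq ?enum_uniq.
by rewrite big_map big_enum/=; apply: eq_bigr => i _; rewrite A'f.
Qed.

Lemma integral_power_measure_reindex mu k n (f : 'I_k -> 'I_n)
    (g : k.-tuple S -> \bar R) :
  injective f -> measurable_fun [set: k.-tuple S] g -> (forall x, 0 <= g x)%E ->
  (\int[power_measure mu n]_x g (reindex_tuple f x) =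
   \int[power_measure mu k]_x g x)%E.
Proof.
move=> fi mg g0; rewrite -(ge0_integral_distribution (reindex_tuple f) mg g0).
apply: eq_measure_integral => A mA _; exact: power_measure_reindex.
Qed.

Definition cat_tuples a b (z : a.-tuple S * b.-tuple S) : (a + b).-tuple S :=
  [tuple of z.1 ++ z.2].

Lemma measurable_cat_tuples a b : measurable_fun setT (@cat_tuples a b).
Proof.
apply/measurable_fun_tnthP => i; rewrite -(splitK i).
case: (fintype.split i) => j /=.
  rewrite (_ : _ \o _ = (@tnth a S)^~ j \o fst).
    by apply: measurableT_comp => //; exact: measurable_tnth.
  by apply/funext => -[x y] /=; rewrite tnth_lshift.
rewrite (_ : _ \o _ = (@tnth b S)^~ j \o snd).
  by apply: measurableT_comp => //; exact: measurable_tnth.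
by apply/funext => -[x y] /=; rewrite tnth_rshift.
Qed.

HB.instance Definition _ a b :=
  @isMeasurableFun.Build _ _ _ _ (@cat_tuples a b) (@measurable_cat_tuples a b).

Lemma power_measure_cat mu a b (B : set ((a + b).-tuple S)) : measurable B ->
  distribution (power_measure mu a \x power_measure mu b)%E (@cat_tuples a b) B =
  power_measure mu (a + b) B.
Proof.
move=> mB; apply: (@tuple_measure_unique _ (distribution
  (power_measure mu a \x power_measure mu b)%E (@cat_tuples a b))
  (power_measure mu (a + b))) => //.
move=> A mA; rewrite power_measure_box//= /distribution /pushforward.
rewrite (_ : _ @^-1` _ = box (A \o lshift b) `*` box (A \o @rshift a b)); last first.
  apply/seteqP; split => [[x y]/= h|[x y]/= [h1 h2] i].
    by split=> i /=; [have := h (lshift b i); rewrite tnth_lshift|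
                      have := h (rshift a i); rewrite tnth_rshift].
  rewrite -(splitK i); case: (fintype.split i) => j /=.
    by rewrite tnth_lshift; exact: h1.
  by rewrite tnth_rshift; exact: h2.
rewrite product_measure1E; [|by apply: measurable_box => i /=..].
rewrite big_split_ord EFinM/=.
by congr (_ * _)%E; apply: power_measure_box => i /=.
Qed.

Lemma integral_power_measure_cat mu a b (g : (a + b).-tuple S -> \bar R) :
  measurable_fun [set: (a + b).-tuple S] g -> (forall x, 0 <= g x)%E ->
  (\int[power_measure mu (a + b)]_x g x =
   \int[power_measure mu a]_s \int[power_measure mu b]_t g (cat_tuples (s, t)))%E.
Proof.
move=> mg g0; transitivity
  (\int[distribution (power_measure mu a \x power_measure mu b)%E
     (@cat_tuples a b)]_x g x)%E.
  by apply: eq_measure_integral => A mA _; exact: esym (power_measure_cat _ mA).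
rewrite ge0_integral_distribution// fubini_tonelli1//; first exact: measurableT_comp.
by move=> x; exact: g0.
Qed.

End power_measure_theory.

(** Two injections with disjoint images are one injection of [a + b] indices, so the integral
    reduces to a product of two powers, where Tonelli applies. *)
Lemma integral_power_measure_indep (R : realType) (d : measure_display)
    (S : measurableType d) (mu : probability S R) a b n
    (h1 : 'I_a -> 'I_n) (h2 : 'I_b -> 'I_n)
    (f1 : a.-tuple S -> R) (f2 : b.-tuple S -> R) :
  injective h1 -> injective h2 -> (forall i j, h1 i != h2 j) ->
  measurable_fun setT f1 -> measurable_fun setT f2 ->
  (forall x, 0 <= f1 x) -> (forall x, 0 <= f2 x) ->
  (\int[power_measure mu n]_x (f1 (reindex_tuple h1 x) * f2 (reindex_tuple h2 x))%:E =
   (\int[power_measure mu a]_x (f1 x)%:E) * \int[power_measure mu b]_x (f2 x)%:E)%E.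
Proof.
move=> h1i h2i h12 mf1 mf2 f10 f20.
pose h (i : 'I_(a + b)) := match fintype.split i with inl i => h1 i | inr i => h2 i end.
have hl i : h (lshift b i) = h1 i by rewrite /h (unsplitK (inl _)).
have hr i : h (rshift a i) = h2 i by rewrite /h (unsplitK (inr _)).
have hi : injective h.
  move=> i j; rewrite -(splitK i) -(splitK j).
  case: (fintype.split i) (fintype.split j) => u [] v /=; rewrite ?hl ?hr.
  - by move=> /h1i ->.
  - by move=> /eqP; rewrite (negbTE (h12 _ _)).
  - by move=> /esym/eqP; rewrite (negbTE (h12 _ _)).
  - by move=> /h2i ->.
pose g (y : (a + b).-tuple S) : R :=
  f1 (reindex_tuple (lshift b) y) * f2 (reindex_tuple (@rshift a b) y).
have mg : measurable_fun setT (fun y => (g y)%:E).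
  apply/measurable_EFinP; apply: measurable_funM;
    [apply: (measurableT_comp mf1)|apply: (measurableT_comp mf2)];
    exact: measurable_reindex_tuple.
have g0 y : (0 <= (g y)%:E)%E by rewrite lee_fin mulr_ge0.
transitivity (\int[power_measure mu n]_x (g (reindex_tuple h x))%:E)%E.
  apply: eq_integral => x _; rewrite /g; congr (f1 _ * f2 _)%:E;
  by apply: eq_from_tnth => i; rewrite !tnth_mktuple ?hl ?hr.
rewrite (@integral_power_measure_reindex _ _ _ mu _ _ h (fun x => (g x)%:E) hi)//.
rewrite integral_power_measure_cat//.
set I2 := (\int[power_measure mu b]_x (f2 x)%:E)%E.
have I20 : (0 <= I2)%E by apply: integral_ge0 => x _; rewrite lee_fin.
transitivity (\int[power_measure mu a]_s (I2 * (f1 s)%:E))%E.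
  apply: eq_integral => s _; rewrite muleC /I2 -ge0_integralZl_EFin//; last 2 first.
  - by move=> t _; rewrite lee_fin.
  - exact/measurable_EFinP.
  apply: eq_integral => t _; rewrite -EFinM /g; congr (f1 _ * f2 _)%:E;
  by apply: eq_from_tnth => i; rewrite tnth_mktuple ?tnth_lshift ?tnth_rshift.
rewrite ge0_integralZl//; first by rewrite muleC.
- exact/measurable_EFinP.
- by move=> s _; rewrite lee_fin.
Qed.

(** * Countably infinite products *)

Definition stream (T : Type) := nat -> T.

Section streams.
Context {d : measure_display} {T : measurableType d}.
Implicit Types (w : stream T) (A : set (stream T)).

HB.instance Definition _ := Pointed.copy (stream T) (nat -> T).

Definition stake n w : n.-tuple T := [tuple w i | i < n].

Definition sext n (t : n.-tuple T) : stream T := fun i => nth point t i.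

Definition scons (x : T) w : stream T := fun i => if i is j.+1 then w j else x.

Lemma sextK n (t : n.-tuple T) : stake n (sext t) = t.
Proof. by apply: eq_from_tnth => i; rewrite tnth_mktuple /sext -tnth_nth. Qed.

Lemma sext_cons n x (t : n.-tuple T) :
  sext (Defs.cons_tuple (x, t)) = scons x (sext t).
Proof. by apply/funext => -[|i]. Qed.

Lemma stake_cons n x w : stake n.+1 (scons x w) = Defs.cons_tuple (x, stake n w).
Proof.
apply: eq_from_tnth => i; rewrite tnth_mktuple.
by case: (unliftP ord0 i) => [j ->|->]//=; rewrite tnthS tnth_mktuple.
Qed.

Lemma stake_widen n m (nm : (n <= m)%N) w :
  stake n w = reindex_tuple (widen_ord nm) (stake m w).
Proof. by apply: eq_from_tnth => i; rewrite !tnth_mktuple. Qed.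

(** Padding with [point] reads off a base for any set [A]. The second half of [is_cyl] says that [A]
    depends on the first [n] coordinates only, and then the padding does not matter. *)
Definition cyl_base n A : set (n.-tuple T) := [set t | A (sext t)].
Arguments cyl_base : clear implicits.

Definition is_cyl n A := measurable (cyl_base n A) /\ A = stake n @^-1` cyl_base n A.

Definition cylinder A := exists n, is_cyl n A.

Lemma is_cyl_preimage n (C : set (n.-tuple T)) :
  measurable C -> is_cyl n (stake n @^-1` C) /\ cyl_base n (stake n @^-1` C) = C.
Proof.
move=> mC; have E : cyl_base n (stake n @^-1` C) = C.
  by apply/seteqP; split => t; rewrite /cyl_base /= sextK.
by rewrite /is_cyl E.
Qed.

Lemma is_cyl_widen n m A : (n <= m)%N -> is_cyl n A ->
  is_cyl m A /\ exists nm : (n <= m)%N,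
    cyl_base m A = reindex_tuple (widen_ord nm) @^-1` cyl_base n A.
Proof.
move=> nm [mA AE].
pose C := reindex_tuple (widen_ord nm) @^-1` cyl_base n A.
have mC : measurable C.
  by rewrite -[C]setTI; exact: measurable_reindex_tuple.
have -> : A = stake m @^-1` C.
  by rewrite {1}AE; apply/seteqP; split => w /=; rewrite (stake_widen nm).
have [? E] := is_cyl_preimage mC; split=> //; exists nm.
rewrite E /C; congr (_ @^-1` _); apply/seteqP.
by split=> t; rewrite /cyl_base/= -stake_widen sextK.
Qed.

Lemma is_cylS n A : is_cyl n A -> is_cyl n.+1 A.
Proof. by move=> /(is_cyl_widen (leqnSn n))[]. Qed.

Lemma is_cyl0 A : is_cyl 0 A -> A !=set0 -> A = setT.
Proof.
move=> [_ AE] [w Aw]; apply/seteqP; split => // w' _; rewrite AE /= /cyl_base/=.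
have -> : stake 0 w' = stake 0 w by apply: eq_from_tnth => -[].
by move: Aw; rewrite {1}AE.
Qed.

Lemma is_cylT n : is_cyl n setT.
Proof.
rewrite -(_ : stake n @^-1` setT = setT)//.
exact: (is_cyl_preimage (@measurableT _ (n.-tuple T))).1.
Qed.

Lemma is_cylC n A : is_cyl n A -> is_cyl n (~` A).
Proof.
move=> [mA AE]; rewrite AE preimage_setC.
exact: (is_cyl_preimage (measurableC mA)).1.
Qed.

Lemma is_cylU n A B : is_cyl n A -> is_cyl n B -> is_cyl n (A `|` B).
Proof.
move=> [mA AE] [mB BE]; rewrite AE BE -preimage_setU.
exact: (is_cyl_preimage (measurableU _ _ mA mB)).1.
Qed.

Lemma cylinder0 : cylinder set0.
Proof. by exists 0%N; rewrite -setCT; exact/is_cylC/is_cylT. Qed.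

Lemma common_cyl A B : cylinder A -> cylinder B ->
  exists n, is_cyl n A /\ is_cyl n B.
Proof.
move=> [n cA] [m cB]; exists (maxn n m).
by split; [exact: (is_cyl_widen (leq_maxl n m) cA).1|
           exact: (is_cyl_widen (leq_maxr n m) cB).1].
Qed.

Lemma cylinderU : setU_closed cylinder.
Proof.
move=> A B /common_cyl/[apply] -[n [cA cB]]; exists n; exact: is_cylU.
Qed.

Lemma cylinderC : setC_closed cylinder.
Proof. by move=> A [n cA]; exists n; exact: is_cylC. Qed.

HB.instance Definition _ := @isAlgebraOfSets.Build d (stream T) cylinder
  cylinder0 cylinderU cylinderC.

Definition ssection x A : set (stream T) := [set w | A (scons x w)].

Lemma cyl_base_section n x A :
  cyl_base n (ssection x A) = xsection (@Defs.cons_tuple _ T n @^-1` cyl_base n.+1 A) x.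
Proof.
apply/seteqP; split => t; rewrite /cyl_base /ssection /xsection /= inE/= sext_cons//.
Qed.

Lemma is_cyl_section n x A : is_cyl n.+1 A -> is_cyl n (ssection x A).
Proof.
move=> [mA AE]; split.
  rewrite cyl_base_section; apply: measurable_xsection.
  by rewrite -[X in measurable X]setTI; exact: measurable_cons_tuple.
rewrite {1}AE; apply/seteqP.
by split => w; rewrite /ssection /cyl_base /= stake_cons sext_cons.
Qed.

Lemma cylinder_section x A : cylinder A -> cylinder (ssection x A).
Proof. by move=> [n /is_cylS cA]; exists n; exact: is_cyl_section. Qed.

End streams.
Arguments cyl_base {d T} n A _.

Section stream_measure.
Context {R : realType} {d : measure_display} {T : measurableType d}.
Variable mu : probability T R.
Implicit Types (w : stream T) (A : set (stream T)).
Local Open Scope ereal_scope.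

(** By [cyl_contentE] the chosen number of coordinates does not affect the value. Sets that are not
    cylinders get the default 0. *)
Definition cyl_content A : \bar R :=
  if pselect (cylinder A) is left h
  then power_measure mu (projT1 (cid h)) (cyl_base (projT1 (cid h)) A) else 0.

Lemma cyl_contentE n A : is_cyl n A ->
  cyl_content A = power_measure mu n (cyl_base n A).
Proof.
have widen k m : (k <= m)%N -> is_cyl k A ->
    power_measure mu m (cyl_base m A) = power_measure mu k (cyl_base k A).
  move=> km cA; have [_ [km' ->]] := is_cyl_widen km cA.
  rewrite -(@power_measure_reindex _ _ _ mu k m (widen_ord km'))//; last exact: cA.1.
  by move=> i j /(congr1 val)/= ij; exact: val_inj.
move=> cA; rewrite /cyl_content; case: pselect => [h|[]]; last by exists n.
case: cid => m /= cmA.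
by have [nm|/ltnW mn] := leqP n m; [exact: widen|apply/esym; exact: widen].
Qed.

Lemma cyl_content_ge0 A : 0 <= cyl_content A.
Proof. by rewrite /cyl_content; case: pselect. Qed.

Lemma cyl_content_le1 A : cylinder A -> cyl_content A <= 1.
Proof. by move=> [n cA]; rewrite (cyl_contentE cA) probability_le1//; exact: cA.1. Qed.

Lemma cyl_content0 : cyl_content set0 = 0.
Proof.
have c0 : @is_cyl _ T 0 set0 by rewrite -setCT; exact/is_cylC/is_cylT.
by rewrite (cyl_contentE c0) (_ : cyl_base _ _ = set0)// measure0.
Qed.

Lemma cyl_contentT : cyl_content setT = 1.
Proof.
by rewrite (cyl_contentE (@is_cylT _ _ 0)) (_ : cyl_base _ _ = setT)// probability_setT.
Qed.

Lemma cyl_content_semi_additive : measure_function.semi_additive cyl_content.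
Proof.
apply/(additive2P cyl_content0) => A B /common_cyl/[apply] -[n [cA cB]] AB0.
rewrite (cyl_contentE (is_cylU cA cB)) (cyl_contentE cA) (cyl_contentE cB).
rewrite (_ : cyl_base n (A `|` B) = cyl_base n A `|` cyl_base n B)//.
rewrite measureU//; [exact: cA.1|exact: cB.1|].
by apply/seteqP; split => // t [At Bt]; have : (A `&` B) (sext t) by []; rewrite AB0.
Qed.

HB.instance Definition _ := isContent.Build _ _ _ cyl_content
  cyl_content_ge0 cyl_content_semi_additive.

Lemma measurable_content_section A : cylinder A ->
  measurable_fun setT (fun x => cyl_content (ssection x A)).
Proof.
move=> [n /is_cylS cA].
rewrite (_ : (fun _ => _) = (power_measure mu n \o
    xsection (@Defs.cons_tuple _ T n @^-1` cyl_base n.+1 A))).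
  apply: measurable_fun_xsection.
  by rewrite -[X in measurable X]setTI; apply: measurable_cons_tuple => //; exact: cA.1.
by apply/funext => x; rewrite (cyl_contentE (is_cyl_section x cA)) cyl_base_section.
Qed.

Lemma integral_content_section A : cylinder A ->
  cyl_content A = \int[mu]_x cyl_content (ssection x A).
Proof.
move=> [n /is_cylS cA]; rewrite (cyl_contentE cA)/= /distribution /pushforward.
apply: eq_integral => x _.
by rewrite (cyl_contentE (is_cyl_section x cA)) cyl_base_section.
Qed.

(* A family of cylinders violating countable subadditivity still violates it
   after fixing a suitable first coordinate; iterating produces a point of A
   outside all the A_i. *)
Lemma bad_section A (F : nat -> set (stream T)) :
  cylinder A -> (forall i, cylinder (F i)) ->
  \sum_(i <oo) cyl_content (F i) < cyl_content A ->
  exists x, \sum_(i <oo) cyl_content (ssection x (F i)) < cyl_content (ssection x A).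
Proof.
move=> cA cF bad; apply/not_existsP => hx.
move: bad; rewrite ltNge; apply/negP/negPn.
rewrite (integral_content_section cA).
rewrite (eq_eseriesr (fun i _ => integral_content_section (cF i))).
rewrite -integral_nneseries//; last first.
  by move=> i; exact: measurable_content_section.
apply: ge0_le_integral => //.
- exact: measurable_content_section.
- apply: ge0_emeasurable_sum => [i x _ _|i _]; first exact: cyl_content_ge0.
  exact: measurable_content_section.
- by move=> x _; rewrite leNgt; apply/negP/hx.
Qed.

(** A cylinder on [n] coordinates becomes, once these are fixed, either empty or the whole space.
    Along the coordinates chosen by [bad_section], [A] can never become empty, so the point [w] lies
    in [A] and hence in some [F i]. That [F i] eventually becomes the whole space, of content 1,
    which contradicts the strict inequality. *)
Lemma cyl_content_sigma_subadditive :
  measurable_subset_sigma_subadditive cyl_content.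
Proof.
move=> A F mF mA AF.
have {}mA : cylinder A by [].
have {}mF i : cylinder (F i) by exact: mF.
rewrite leNgt; apply/negP => bad.
pose bad_pair (s : set (stream T) * (nat -> set (stream T))) :=
  [/\ cylinder s.1, forall i, cylinder (s.2 i) &
      \sum_(i <oo) cyl_content (s.2 i) < cyl_content s.1].
pose sec x (s : set (stream T) * (nat -> set (stream T))) :=
  (ssection x s.1, fun i => ssection x (s.2 i)).
have /boolp.choice[f fP] : forall s, exists x, bad_pair s -> bad_pair (sec x s).
  move=> s.
  have [bs|] := pselect (bad_pair s); last by exists point.
  have [c1 c2 c3] := bs; have [x bx] := bad_section c1 c2 c3; exists x => _.
  by split=> //= [|i]; exact: cylinder_section.
pose st n := iter n (fun s => sec (f s) s) (A, F).
pose w n := f (st n).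
have bad_st n : bad_pair (st n).
  by elim: n => [|n IH]; [split|exact: fP].
(* [st k] is the family after fixing the first [k] coordinates of [w], and [shift k] is the
   remaining tail of [w]. *)
pose shift k : stream T := fun i => w (k + i)%N.
have shiftE k : scons (w k) (shift k.+1) = shift k.
  by apply/funext => -[|i]; rewrite /shift /= ?addn0// addSnnS.
have memA k : (st k).1 (shift k) <-> A w.
  elim: k => [|k <-]; first by rewrite /= (_ : shift 0%N = w).
  by rewrite -(shiftE k).
have memF i k : (st k).2 i (shift k) <-> F i w.
  elim: k => [|k <-]; first by rewrite /= (_ : shift 0%N = w).
  by rewrite -(shiftE k).
have cyl_st (sel : set (stream T) * (nat -> set (stream T)) -> set (stream T)) :
    (forall x s, sel (sec x s) = ssection x (sel s)) ->
    cylinder (sel (A, F)) -> exists n, is_cyl 0 (sel (st n)).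
  move=> selE [n cn]; exists n.
  suff : forall k, (k <= n)%N -> is_cyl (n - k) (sel (st k)).
    by move=> /(_ n (leqnn n)); rewrite subnn.
  elim=> [_|k IH kn]; first by rewrite subn0.
  rewrite /st iterS selE; apply: is_cyl_section.
  by rewrite -subSn// subSS; apply: IH; exact: ltnW.
have Aw : A w.
  have [n c0] := cyl_st (@fst _ _) (fun _ _ => erefl) mA.
  apply/(memA n); rewrite (is_cyl0 c0)//; apply/set0P/eqP => st0.
  by have [_ _] := bad_st n; rewrite st0 cyl_content0 ltNge nneseries_ge0.
have [i _ Fiw] := AF _ Aw.
have [n c0] := cyl_st (fun s => s.2 i) (fun _ _ => erefl) (mF i).
have stT : (st n).2 i = setT.
  by apply: (is_cyl0 c0); exists (shift n); apply/memF.
have [c1 _] := bad_st n; rewrite ltNge => /negP; apply.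
apply: le_trans (cyl_content_le1 c1) _; rewrite -cyl_contentT -stT.
by rewrite (@nneseriesD1 _ _ i)// leeDl// nneseries_ge0.
Qed.

HB.instance Definition _ := Content_SigmaSubAdditive_isMeasure.Build _ _ _
  cyl_content cyl_content_sigma_subadditive.

Definition streamType : measurableType _ :=
  g_sigma_algebraType (@measurable _ (stream T)).

Definition stream_measure : set streamType -> \bar R := measure_extension cyl_content.

HB.instance Definition _ := Measure.on stream_measure.

Lemma stream_measure_cyl A : cylinder A -> stream_measure A = cyl_content A.
Proof. by move=> cA; rewrite /stream_measure /measure_extension measurable_mu_extE. Qed.

Lemma stream_measureT : stream_measure setT = 1.
Proof. by rewrite stream_measure_cyl ?cyl_contentT//; exists 0%N; exact: is_cylT. Qed.

HB.instance Definition _ := Measure_isProbability.Build _ _ _ stream_measure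
  stream_measureT.

Lemma measurable_stake n : measurable_fun [set: streamType] (@stake _ T n).
Proof.
move=> _ B mB; rewrite setTI; apply: sub_sigma_algebra.
by exists n; exact: (is_cyl_preimage mB).1.
Qed.

Lemma measurable_stream i : measurable_fun [set: streamType] (fun w : streamType => w i).
Proof.
rewrite (_ : (fun w => w i) = (fun t => tnth t ord_max) \o @stake _ T i.+1).
  by apply: measurableT_comp; [exact: measurable_tnth|exact: measurable_stake].
by apply/funext => w /=; rewrite tnth_mktuple.
Qed.

Lemma stream_measure_stake n (B : set (n.-tuple T)) : measurable B ->
  stream_measure (stake n @^-1` B) = power_measure mu n B.
Proof.
move=> mB; have [cB BE] := is_cyl_preimage mB.
rewrite stream_measure_cyl; last by exists n.
by rewrite (cyl_contentE cB) BE.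
Qed.

End stream_measure.

(** * A realization of G(oo, W) *)

Lemma uniform01_le (R : realType) (w : R) : 0 <= w <= 1 ->
  uniform_prob (@ltr01 R) [set x | x <= w] = w%:E.
Proof.
move=> /andP[w0 w1]; rewrite /uniform_prob integral_uniform_pdf.
have -> : [set x | x <= w] `&` `[0, 1]%classic = `[0, w]%classic.
  apply/seteqP; split => x /=; rewrite !in_itv/=.
    by move=> [-> /andP[->]].
  by move=> /andP[-> xw]; rewrite xw (le_trans xw).
rewrite (eq_integral (fun=> 1%:E)); last first.
  move=> x; rewrite inE/= in_itv/= /uniform_pdf => /andP[-> xw].
  by rewrite (le_trans xw)//= subr0 invr1.
rewrite integral_cst//= mul1e lebesgue_measure_itv/= lte_fin.
by case: ltgtP w0 => // [_ _|<- _]; rewrite ?sube0 ?EFinN ?oppr0 ?adde0.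
Qed.

Section stream_independence.
Context {R : realType} {d : measure_display} {T : measurableType d}.
Variable mu : probability T R.

Lemma stream_measure_box (I : finType) (c : I -> nat) (B : I -> set T) :
  injective c -> (forall i, measurable (B i)) ->
  stream_measure mu [set u | forall i, B i (u (c i))] =
  (\prod_i fine (mu (B i)))%:E.
Proof.
move=> ci mB; pose N := (\max_i c i).+1.
have cN i : (c i < N)%N by rewrite ltnS leq_bigmax.
pose f (i : 'I_#|I|) : 'I_N := Ordinal (cN (enum_val i)).
have fi : injective f by move=> i j /(congr1 val) /= /ci /enum_val_inj.
have mbox : measurable (box (B \o @enum_val I predT)).
  by apply: measurable_box => i /=.
rewrite (_ : [set u | _] = stake N @^-1`
    (reindex_tuple f @^-1` box (B \o @enum_val I predT))); last first.
  apply/seteqP; split => u /= h i; first by rewrite !tnth_mktuple; exact: h.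
  have := h (enum_rank i); rewrite !tnth_mktuple/= enum_rankK//.
rewrite stream_measure_stake; last first.
  by rewrite -[X in measurable X]setTI; exact: measurable_reindex_tuple.
have := power_measure_reindex mu fi mbox; rewrite /distribution /pushforward => ->.
rewrite power_measure_box => [|i]; last exact: mB.
congr EFin; rewrite [RHS](reindex (@enum_val I predT))//=.
exact/onW_bij/enum_val_bij.
Qed.

Lemma integral_stream_stake n (D : set (n.-tuple T)) (f : n.-tuple T -> \bar R) :
  measurable D -> measurable_fun D f -> (forall x, 0 <= f x)%E ->
  (\int[stream_measure mu]_(w in stake n @^-1` D) f (stake n w) =
   \int[power_measure mu n]_(x in D) f x)%E.
Proof.
move=> mD mf f0.
rewrite -(ge0_integral_pushforward (@measurable_stake _ T n) (stream_measure mu) mD mf)//.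
pose mixin := isMeasurableFun.Build _ _ _ _ _ (@measurable_stake _ T n).
pose X : {mfun streamType (T := T) >-> n.-tuple T} :=
  HB.pack (@stake _ T n : streamType (T := T) -> n.-tuple T) mixin.
rewrite -[LHS]/(\int[distribution (stream_measure mu) X]_(x in D) f x)%E.
by apply: eq_measure_integral => A mA _; exact: stream_measure_stake.
Qed.

End stream_independence.

Section realization.
Context {R : realType} {d : measure_display} {S : measurableType d}.
Variables (mu : probability S R) (W : S * S -> R).
Hypothesis mW : measurable_fun setT W.
Hypothesis W01 : forall z, 0 <= W z <= 1.

Lemma oriented_is_tournament (b : nat -> nat -> bool) :
  is_tournament (fun i j => if (i < j)%N then b i j
                            else if (j < i)%N then ~~ b j i else false).
Proof.
split => [i|i j]; first by rewrite ltnn.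
by case: ltngtP => //; rewrite negbK.
Qed.

Definition oriented b := Tournament (oriented_is_tournament b).

Let U := @stream_measure R _ _ (uniform_prob (@ltr01 R)).
Let code (i j : nat) : nat := pickle (i, j).

(** A uniform coordinate falls below [W (z.1 i, z.1 j)] with exactly that probability. Each pair has
    its own coordinate because [pickle] is injective, so the edges are independent given the
    types. *)
Definition G_edge (z : streamType (T := S) * streamType (T := measurableTypeR R)) i j :=
  z.2 (code i j) <= W (z.1 i, z.1 j).

Lemma measurable_G_edge i j : measurable_fun setT (fun z => G_edge z i j).
Proof.
apply: measurable_fun_ler.
  by apply: (measurableT_comp (measurable_stream _)).
apply: (measurableT_comp mW); apply: measurable_fun_pair => /=.
  by apply: (measurableT_comp (measurable_stream _)).
by apply: (measurableT_comp (measurable_stream _)).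
Qed.

Definition edge_prod n (F : tournament 'I_n) (x : n.-tuple S) : R :=
  \prod_(p : 'I_n * 'I_n | (p.1 < p.2)%N)
    (if F p.1 p.2 then W (tnth x p.1, tnth x p.2)
     else 1 - W (tnth x p.1, tnth x p.2)).

Lemma measurable_W_tnth n (i j : 'I_n) :
  measurable_fun setT (fun x : n.-tuple S => W (tnth x i, tnth x j)).
Proof.
apply: (measurableT_comp mW).
by apply: measurable_fun_pair; exact: measurable_tnth.
Qed.

Lemma measurable_edge_prod n (F : tournament 'I_n) :
  measurable_fun setT (edge_prod F).
Proof.
rewrite (_ : edge_prod F = (fun x => \prod_(p : 'I_n * 'I_n)
    if (p.1 < p.2)%N then
      if F p.1 p.2 then W (tnth x p.1, tnth x p.2)
      else 1 - W (tnth x p.1, tnth x p.2)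
    else 1)); last by apply/funext => x; rewrite /edge_prod big_mkcond.
apply: measurable_prod => p _; case: (p.1 < p.2)%N => //; case: (F p.1 p.2).
  exact: measurable_W_tnth.
by apply: measurable_funB => //; exact: measurable_W_tnth.
Qed.

Lemma edge_prod_ge0 n (F : tournament 'I_n) x : 0 <= edge_prod F x.
Proof.
apply: prodr_ge0 => p _; have /andP[W0 W1] := W01 (tnth x p.1, tnth x p.2).
by case: ifP => // _; rewrite subr_ge0.
Qed.

Lemma uniform_edges n (F : tournament 'I_n) (w : stream S) :
  U [set u | forall i j : 'I_n, oriented (G_edge (w, u)) i j = F i j] =
  (edge_prod F (stake n w))%:E.
Proof.
pose B (p : 'I_n * 'I_n) : set (measurableTypeR R) := if (p.1 < p.2)%N then
   [set x | (x <= W (w p.1, w p.2)) = F p.1 p.2] else setT.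
have mle c : measurable [set x : measurableTypeR R | x <= c].
  have -> : [set x | x <= c] = `]-oo, c]%classic.
    by apply/seteqP; split => x /=; rewrite in_itv.
  exact: measurable_itv.
have BE (p : 'I_n * 'I_n) : (p.1 < p.2)%N ->
    B p = if F p.1 p.2 then [set x | x <= W (w p.1, w p.2)]
    else ~` [set x | x <= W (w p.1, w p.2)].
  move=> p12; rewrite /B p12; case: (F _ _); first by [].
  by apply/seteqP; split => x /=; [move=> ->|move=> /negP/negbTE].
have mB (p : 'I_n * 'I_n) : measurable (B p).
  have [p12|p12] := boolP (p.1 < p.2)%N; last by rewrite /B (negbTE p12).
  by rewrite BE//; case: ifP => _; [|apply: measurableC]; exact: mle.
rewrite (_ : [set u | _] = [set u : stream (measurableTypeR R) |
    forall p : 'I_n * 'I_n, B p (u (code p.1 p.2))]); last first.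
  apply/seteqP; split => u /= h.
    move=> p; rewrite /B; case: ifP => // p12.
    by have := h p.1 p.2; rewrite p12.
  move=> i j; case: ltngtP => ij.
  - by have := h (i, j); rewrite /B /= ij.
  - have := h (j, i); rewrite /B /= ij /G_edge /= => ->.
    by rewrite -tournament_anti// -val_eqE /= neq_ltn ij orbT.
  - by have -> : i = j by [exact: val_inj]; rewrite tournament_irr.
rewrite /U stream_measure_box//; last first.
  by move=> [i j] [i' j'] /= /(pcan_inj pickleK)[/val_inj-> /val_inj->].
congr EFin; rewrite /edge_prod [RHS]big_mkcond/=; apply: eq_bigr => p _.
case: ifP => p12; last by rewrite /B p12 probability_setT.
rewrite BE// !tnth_mktuple; case: ifP => _; first by rewrite uniform01_le.
transitivity (fine (1 - uniform_prob (@ltr01 R) [set x | x <= W (w p.1, w p.2)]%R)%E).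
  by congr fine; exact: probability_setC.
by rewrite uniform01_le.
Qed.

Lemma exists_realization : exists (d' : measure_display) (Omega : measurableType d')
  (P : probability Omega R) (X : nat -> Omega -> S) (G : Omega -> tournament nat),
  is_G_infty mu W P X G.
Proof.
pose Om : measurableType _ :=
  (streamType (T := S) * streamType (T := measurableTypeR R))%type.
exists _, Om, (stream_measure mu \x U)%E,
  (fun i z => z.1 i), (fun z => oriented (G_edge z)).
have mX i : measurable_fun [set: Om] (fun z => z.1 i).
  exact: (measurableT_comp (measurable_stream _)).
have mG i j : measurable [set z : Om | oriented (G_edge z) i j].
  rewrite /=; case: (i < j)%N; [|case: (j < i)%N].
  - by rewrite -[X in measurable X]setTI; exact: measurable_G_edge.
  - rewrite -[X in measurable X]setTI.
    by apply: (measurable_neg (measurable_G_edge j i)).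
  - by rewrite (_ : [set _ | _] = set0)//; apply/seteqP; split.
split => // n F A mA.
set E := [set z | _].
rewrite /= /product_measure1/=.
transitivity (\int[stream_measure mu]_(w in stake n @^-1` box A)
    (edge_prod F (stake n w))%:E)%E.
  rewrite [RHS]integral_mkcond; apply: eq_integral => w _ /=.
  rewrite patchE; case: ifPn => [/set_mem/= wA|wA].
    rewrite -uniform_edges; congr (U _); apply/seteqP; split => u /=.
      by rewrite /xsection /= inE => -[].
    move=> h; rewrite /xsection /= inE; split => // i.
    by have := wA i; rewrite tnth_mktuple.
  rewrite (_ : xsection E w = set0) ?measure0//; apply/seteqP; split => u //.
  rewrite /xsection /= inE => -[h _]; move/negP: wA; apply; apply/mem_set => i.
  by rewrite tnth_mktuple; exact: h.
rewrite (@integral_stream_stake _ _ _ mu n (box A) (fun x => (edge_prod F x)%:E))//.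
- exact: measurable_box.
- by apply: measurable_funTS; apply/measurable_EFinP; exact: measurable_edge_prod.
- by move=> x; rewrite lee_fin edge_prod_ge0.
Qed.

End realization.

(** * Densities of a kernel *)

Lemma ge0_integral_bigsum (R : realType) d (T : measurableType d)
    (P : {measure set T -> \bar R}) (I : finType) (Q : pred I) (f : I -> T -> R) :
  (forall i, measurable_fun setT (f i)) -> (forall i x, 0 <= f i x) ->
  (\int[P]_x (\sum_(i | Q i) f i x)%:E = \sum_(i | Q i) \int[P]_x (f i x)%:E)%E.
Proof.
move=> mf f0; rewrite -big_filter -ge0_integral_sum//.
- by apply: eq_integral => x _; rewrite -sumEFin big_filter.
- by move=> i; exact/measurable_EFinP.
- by move=> i x _; rewrite lee_fin.
Qed.

(** * Edges forced by an embedded tournament *)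

Section tournament_pushforward.
Variables (k n : nat) (F : tournament 'I_k) (f : {ffun 'I_k -> 'I_n}).

Definition image_edges : {set 'I_n * 'I_n} :=
  (fun p => (f p.1, f p.2)) @: edge_set F.

Lemma image_edgesP i j :
  reflect (exists a b, [/\ F a b, i = f a & j = f b]) ((i, j) \in image_edges).
Proof.
apply: (iffP imsetP) => [[[a b]]|[a [b [Fab -> ->]]]].
  by rewrite inE /= => Fab [-> ->]; exists a, b.
by exists (a, b); rewrite ?inE.
Qed.

Hypothesis f_inj : injective f.

Lemma image_edges_anti : {in image_edges, forall p, (p.2, p.1) \notin image_edges}.
Proof.
move=> [i j] /image_edgesP[a [b [Fab -> ->]]] /=; apply/negP.
move=> /image_edgesP[a' [b' [Fab' /f_inj ? /f_inj ?]]]; subst a' b'.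
have [ab|ab] := eqVneq a b; first by move: Fab; rewrite ab tournament_irr.
by move: Fab; rewrite tournament_anti// Fab'.
Qed.

(** Containing the images of the edges suffices: a pair of distinct vertices that is not an edge of
    [F] is the reverse of one, so its image cannot be an edge of [H]. *)
Lemma embeds_image_edges (H : tournament 'I_n) :
  embeds F H f = (image_edges \subset edge_set H).
Proof.
apply/idP/fintype.subsetP => [/forallP fP [i j]|sub].
  move=> /image_edgesP[a [b [Fab -> ->]]]; rewrite inE /=.
  by have /forallP/(_ b)/eqP -> := fP a.
have subF a b : F a b -> H (f a) (f b).
  move=> Fab; have := sub (f a, f b); rewrite inE; apply.
  by apply/image_edgesP; exists a, b.
apply/forallP => i; apply/forallP => j; apply/eqP.
have [->|ij] := eqVneq i j; first by rewrite !tournament_irr.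
apply/idP/idP => [Hij|/subF//]; rewrite tournament_anti//; apply/negP => /subF.
by rewrite tournament_anti ?Hij// eq_sym (inj_eq f_inj).
Qed.

Lemma prod_image_edges (R : comPzRingType) (w : 'I_n -> 'I_n -> R) :
  \prod_(p in image_edges) w p.1 p.2 = \prod_(p | F p.1 p.2) w (f p.1) (f p.2).
Proof.
rewrite big_imset/=; last by move=> [a b] [a' b'] _ _ /= [/f_inj -> /f_inj ->].
by apply: eq_bigl => p; rewrite inE.
Qed.

End tournament_pushforward.

Section kernel_density.
Context {R : realType} {d : measure_display} {S : measurableType d}.
Variable W : S * S -> R.
Hypothesis mW : measurable_fun setT W.
Hypothesis W01 : forall z, 0 <= W z <= 1.
Hypothesis W_anti : forall x y, W (x, y) + W (y, x) = 1.
Implicit Type mu : probability S R.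

Definition kw n (x : n.-tuple S) (i j : 'I_n) : R := W (tnth x i, tnth x j).

Definition dens mu k (F : tournament 'I_k) : R :=
  fine (\int[power_measure mu k]_x (weight (kw x) F)%:E)%E.

Lemma measurable_weight k (F : tournament 'I_k) :
  measurable_fun setT (fun x : k.-tuple S => weight (kw x) F).
Proof.
rewrite (_ : (fun _ => _) = (fun x => \prod_(p : 'I_k * 'I_k)
    if F p.1 p.2 then kw x p.1 p.2 else 1)); last first.
  by apply/funext => x; rewrite /weight big_mkcond.
apply: measurable_prod => p _; case: (F _ _) => //; exact: measurable_W_tnth.
Qed.

Lemma emeasurable_weight k (F : tournament 'I_k) :
  measurable_fun setT (fun x : k.-tuple S => (weight (kw x) F)%:E).
Proof. by apply/measurable_EFinP; exact: measurable_weight. Qed.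

Lemma weight_ge0 k (x : k.-tuple S) (F : tournament 'I_k) : 0 <= weight (kw x) F.
Proof. by apply: prodr_ge0 => p _; case/andP: (W01 (tnth x p.1, tnth x p.2)). Qed.

Lemma weight_le1 k (x : k.-tuple S) (F : tournament 'I_k) : weight (kw x) F <= 1.
Proof. by apply: prodr_ile1 => p _; exact: W01. Qed.

Lemma integral_unit_fin_num d' (T : measurableType d') (P : probability T R)
    (f : T -> R) :
  measurable_fun setT f -> (forall x, 0 <= f x <= 1) ->
  (\int[P]_x (f x)%:E)%E \is a fin_num.
Proof.
move=> mf f01; rewrite ge0_fin_numE; last first.
  by apply: integral_ge0 => x _; rewrite lee_fin; case/andP: (f01 x).
apply: (@le_lt_trans _ _ (\int[P]_x 1)%E).
  apply: ge0_le_integral => //.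
  - by move=> x _; rewrite lee_fin; case/andP: (f01 x).
  - exact/measurable_EFinP.
  - by move=> x _; rewrite lee_fin; case/andP: (f01 x).
by rewrite integral_cst//= probability_setT mul1e ltry.
Qed.

Lemma densE mu k (F : tournament 'I_k) :
  ((dens mu F)%:E = \int[power_measure mu k]_x (weight (kw x) F)%:E)%E.
Proof.
rewrite fineK//; apply: integral_unit_fin_num; first exact: measurable_weight.
by move=> x; rewrite weight_ge0 weight_le1.
Qed.

Lemma dens_ge0 mu k (F : tournament 'I_k) : 0 <= dens mu F.
Proof.
by apply/fine_ge0/integral_ge0 => x _; rewrite lee_fin weight_ge0.
Qed.

Lemma sum_dens mu k (Q : pred (tournament 'I_k)) :
  ((\sum_(F | Q F) dens mu F)%:E =
   \int[power_measure mu k]_x (\sum_(F | Q F) weight (kw x) F)%:E)%E.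
Proof.
rewrite ge0_integral_bigsum; last 2 first.
- exact: measurable_weight.
- by move=> F x; exact: weight_ge0.
by rewrite -sumEFin; apply: eq_bigr => F _; rewrite densE.
Qed.

Lemma kw_anti n (x : n.-tuple S) i j : i != j -> kw x i j + kw x j i = 1.
Proof. by move=> _; exact: W_anti. Qed.

Lemma sum_densT mu k : \sum_(F : tournament 'I_k) dens mu F = 1.
Proof.
apply: EFin_inj; rewrite sum_dens; under eq_integral.
  move=> x _; rewrite (sum_weight (@kw_anti k x)); over.
by rewrite integral_cst//= probability_setT mul1e.
Qed.

(** For fixed types, the pairs not forced by the embedding sum to 1 by [sum_extensions]; the types
    outside the image of [f] then integrate out. *)
Lemma dens_sub mu k n (F : tournament 'I_k) (f : {ffun 'I_k -> 'I_n}) :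
  injective f -> \sum_(H | embeds F H f) dens mu H = dens mu F.
Proof.
move=> fi; apply: EFin_inj; rewrite sum_dens densE.
rewrite -(@integral_power_measure_reindex _ _ _ mu k n f
  (fun x => (weight (kw x) F)%:E) fi); last 2 first.
- exact: emeasurable_weight.
- by move=> x; rewrite lee_fin weight_ge0.
apply: eq_integral => x _; congr EFin.
under eq_bigl do rewrite embeds_image_edges//.
rewrite (sum_extensions (@kw_anti n x)); last exact: image_edges_anti.
rewrite prod_image_edges//; apply: eq_bigr => p _.
by rewrite /kw !tnth_mktuple.
Qed.

(** The two sets of forced edges are disjoint and involve disjoint sets of vertices, so both the
    product of weights and its integral factor. *)
Lemma dens_indep mu k l n (F1 : tournament 'I_k) (F2 : tournament 'I_l)
    (f : {ffun 'I_(k + l) -> 'I_n}) : injective f ->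
  \sum_(H | embeds F1 H [ffun i => f (lshift l i)] &&
            embeds F2 H [ffun i => f (rshift k i)]) dens mu H =
  dens mu F1 * dens mu F2.
Proof.
move=> fi; set fl := [ffun i => f (lshift l i)]; set fr := [ffun i => f (rshift k i)].
have fli : injective fl by move=> i j; rewrite !ffunE => /fi/lshift_inj.
have fri : injective fr by move=> i j; rewrite !ffunE => /fi/rshift_inj.
have flr i j : fl i != fr j.
  by apply/eqP; rewrite !ffunE => /fi/eqP; rewrite eq_lrshift.
have dis : fintype.disjoint (mem (image_edges F1 fl)) (mem (image_edges F2 fr)).
  apply/pred0P => -[i j] /=; apply/negP => /andP[].
  move=> /image_edgesP[a [b [_ -> _]]] /image_edgesP[a' [b' [_ /eqP + _]]].
  by apply/negP; exact: flr.
have anti : {in image_edges F1 fl :|: image_edges F2 fr, forall p,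
    (p.2, p.1) \notin image_edges F1 fl :|: image_edges F2 fr}.
  move=> p; rewrite !inE negb_or => /orP[] pE.
    rewrite (image_edges_anti fli pE)/=; case: p pE => i j.
    move=> /image_edgesP[a [b [_ -> ->]]]; apply/negP.
    by move=> /image_edgesP[a' [b' [_ /eqP + _]]]; apply/negP; exact: flr.
  rewrite (image_edges_anti fri pE) andbT; case: p pE => i j.
  move=> /image_edgesP[a [b [_ -> ->]]]; apply/negP.
  by move=> /image_edgesP[a' [b' [_ /esym/eqP + _]]]; apply/negP; exact: flr.
apply: EFin_inj; rewrite sum_dens EFinM !densE.
rewrite -(@integral_power_measure_indep _ _ _ mu k l n fl fr) //; last 4 first.
- exact: measurable_weight.
- exact: measurable_weight.
- by move=> x; exact: weight_ge0.
- by move=> x; exact: weight_ge0.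
apply: eq_integral => x _; congr EFin.
under eq_bigl do rewrite !embeds_image_edges// -finset.subUset.
rewrite (sum_extensions (@kw_anti n x)) //.
rewrite (eq_bigl [predU image_edges F1 fl & image_edges F2 fr]); last first.
  by move=> p; rewrite !inE.
rewrite bigU//= !prod_image_edges//.
by congr (_ * _); apply: eq_bigr => p _; rewrite /kw !tnth_mktuple.
Qed.

(** The measure is arbitrary here: the two summands of a reducible kernel arise by applying this to
    [mu] conditioned on [B] and on its complement. *)
Lemma dens_is_limit mu : is_tournament_limit (dens mu).
Proof.
apply: limit_of_samples => K; apply: exists_good_sample.
- by move=> n H; exact: dens_ge0.
- exact: sum_densT.
- by move=> k n F f; exact: dens_sub.
- by move=> k n F f fi; rewrite expr2; exact: dens_indep.
Qed.

End kernel_density.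

(** * Conditional measures *)

Section conditional.
Context {R : realType} {d : measure_display} {T : measurableType d}.
Variables (P : probability T R) (B : set T).
Hypothesis mB : measurable B.
Hypothesis PB : (0 < P B)%E.

(** The second argument of [mnormalize] is the value returned when [P B] is 0, a case that [PB]
    excludes. *)
Definition conditional : set T -> \bar R := mnormalize (mrestr P mB) P.

HB.instance Definition _ := Measure.on conditional.
HB.instance Definition _ :=
  Measure_isProbability.Build _ _ _ conditional
    (@probability_setT _ _ _ (mnormalize (mrestr P mB) P)).

Lemma conditionalE A : conditional A = (P (A `&` B) * (fine (P B))^-1%:E)%E.
Proof.
rewrite /conditional /mnormalize/= /mrestr/= setTI ifF//.
by rewrite gt_eqF//= lt_eqF// -ge0_fin_numE// fin_num_measure.
Qed.

Lemma integral_conditional (f : T -> \bar R) :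
  measurable_fun setT f -> (forall x, 0 <= f x)%E ->
  (\int[P]_(x in B) f x = P B * \int[conditional]_x f x)%E.
Proof.
move=> mf f0.
have PBfin : P B \is a fin_num by rewrite fin_num_measure.
have r0 : 0 < fine (P B) by rewrite fine_gt0// PB -ge0_fin_numE.
have rV0 : 0 <= (fine (P B))^-1 by rewrite invr_ge0 ltW.
have -> : (\int[conditional]_x f x =
    \int[mscale (NngNum rV0) (mrestr P mB)]_x f x)%E.
  apply: eq_measure_integral => A mA _.
  by rewrite [LHS]conditionalE /mscale/= /mrestr/= muleC.
rewrite ge0_integral_mscale//= muleA -{1}(fineK PBfin) -EFinM divff ?gt_eqF// mul1e.
have split_int := @ge0_integral_setU _ _ _ (mrestr P mB) B (~` B) mB (measurableC mB) f.
rewrite setUv in split_int; rewrite split_int//; last by apply/eqP; rewrite setICr.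
rewrite [X in (_ + X)%E]null_set_integral ?adde0//.
- by apply: eq_measure_integral => A mA AB; rewrite /= /mrestr/= setIidl.
- exact: measurableC.
- exact: measurable_funTS.
- by rewrite /= /mrestr setICl measure0.
Qed.

End conditional.

Section power_measure_conditional.
Context {R : realType} {d : measure_display} {S : measurableType d}.
Variables (mu : probability S R) (B : set S).
Hypothesis mB : measurable B.
Hypothesis muB : (0 < mu B)%E.

Lemma power_measure_box_cst n :
  power_measure mu n (box (fun=> B)) = (fine (mu B) ^+ n)%:E.
Proof. by rewrite power_measure_box// prodr_const card_ord. Qed.

(** Conditioning a power of [mu] on all coordinates lying in [B] gives the power of the conditioned
    measure; it is enough to compare the two on boxes. *)
Lemma integral_power_measure_conditional n (f : n.-tuple S -> \bar R) :
  measurable_fun setT f -> (forall x, 0 <= f x)%E ->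
  (\int[power_measure mu n]_(x in box (fun=> B)) f x =
   (fine (mu B) ^+ n)%:E * \int[power_measure (conditional mu mB) n]_x f x)%E.
Proof.
move=> mf f0; have mbox : measurable (box (fun _ : 'I_n => B)) by exact: measurable_box.
have r0 : 0 < fine (mu B) by rewrite fine_gt0// muB -ge0_fin_numE// fin_num_measure.
have pB : (0 < power_measure mu n (box (fun=> B)))%E.
  by rewrite power_measure_box_cst lte_fin exprn_gt0.
rewrite (integral_conditional mbox pB mf f0) power_measure_box_cst; congr (_ * _)%E.
apply: eq_measure_integral => A mA _.
apply: (@tuple_measure_unique _ _ _ n (conditional (power_measure mu n) mbox)
  (power_measure (conditional mu mB) n)) => // C mC.
rewrite power_measure_box//.
rewrite [LHS](conditionalE mbox pB) power_measure_box_cst/=.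
rewrite (_ : box C `&` _ = box (fun i => C i `&` B)); last first.
  by apply/seteqP; split => [x [xC xB] i|x xCB]; [split|split=> i; case: (xCB i)].
rewrite power_measure_box; last by move=> i; exact: measurableI.
rewrite -EFinM -exprVn -[n in X in _ * X]card_ord -prodr_const -big_split/=.
congr EFin; apply: eq_bigr => i _.
rewrite -[RHS]/(fine (conditional mu mB (C i))) (conditionalE mB muB) fineM//.
by rewrite fin_num_measure//; exact: measurableI.
Qed.

End power_measure_conditional.

Section ae_pairs.
Context {R : realType} {d : measure_display} {S : measurableType d}.
Variable mu : probability S R.

Definition tnth_pair n (i j : 'I_n) (x : n.-tuple S) := (tnth x i, tnth x j).

Lemma measurable_tnth_pair n (i j : 'I_n) : measurable_fun setT (tnth_pair i j).
Proof. by apply: measurable_fun_pair; exact: measurable_tnth. Qed.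

HB.instance Definition _ n (i j : 'I_n) :=
  @isMeasurableFun.Build _ _ _ _ (tnth_pair i j) (measurable_tnth_pair i j).

Lemma power_measure_pair n (i j : 'I_n) (C : set (S * S)) : i != j ->
  measurable C ->
  power_measure mu n (tnth_pair i j @^-1` C) = (mu \x mu)%E C.
Proof.
move=> ij mC.
rewrite (@product_measure_unique _ _ _ _ _ _ _
  (distribution (power_measure mu n) (tnth_pair i j)))//.
move=> A B mA mB; rewrite /= /distribution /pushforward.
pose D k := if k == i then A else if k == j then B else setT.
rewrite (_ : _ @^-1` _ = box D); last first.
  apply/seteqP; split => [x/= [xA xB] k|x xD].
    by rewrite /D; case: eqP => [->//|_]; case: eqP => [->|].
  split; [have := xD i|have := xD j]; rewrite /D ?eqxx//.
  by rewrite eq_sym (negbTE ij).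
rewrite power_measure_box; last by move=> k; rewrite /D; case: ifP => // _; case: ifP.
rewrite (bigD1 i)//= (bigD1 j) 1?eq_sym//= big1 ?mulr1; last first.
  by move=> k /andP[/negbTE ki /negbTE kj]; rewrite /D ki kj probability_setT.
by rewrite /D !eqxx eq_sym (negbTE ij) EFinM !fineK// fin_num_measure.
Qed.

(** Two distinct coordinates are distributed as [mu \x mu]. The diagonal has to be excluded, since
    it may be a null set of [mu \x mu]. *)
Lemma ae_pairs n (Q : S * S -> Prop) : {ae (mu \x mu)%E, forall z, Q z} ->
  {ae power_measure mu n, forall x, forall i j, i != j -> Q (tnth x i, tnth x j)}.
Proof.
move=> [N [mN N0 NQ]].
apply: filter_forall => i; apply: filter_forall => j.
have [->|ij] := eqVneq i j; first exact: aeW.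
exists (tnth_pair i j @^-1` N); split.
- by rewrite -[X in measurable X]setTI; exact: measurable_tnth_pair.
- by rewrite power_measure_pair.
- by move=> x /= hx; apply: NQ => /= hQ; exact: hx.
Qed.

End ae_pairs.

(** * Reducible kernels *)

Section oplus.
Context {R : realType} {d : measure_display} {S : measurableType d}.
Variables (W : S * S -> R) (mu : probability S R) (B : set S).
Hypothesis mW : measurable_fun setT W.
Hypothesis W01 : forall z, 0 <= W z <= 1.
Hypothesis W_anti : forall x y, W (x, y) + W (y, x) = 1.
Hypothesis mB : measurable B.
Hypothesis muB : (0 < mu B < 1)%E.
Hypothesis WB : {ae (mu \x mu)%E, forall z, (B `*` ~` B) z -> W z = 1}.

Let r := fine (mu B).
Let rE : mu B = r%:E. Proof. by rewrite fineK// fin_num_measure. Qed.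
Let muBC : (0 < mu (~` B))%E.
Proof. by rewrite probability_setC// sube_gt0; case/andP: muB. Qed.
Let muB0 : (0 < mu B)%E. Proof. by case/andP: muB. Qed.

Lemma fine_muC : fine (mu (~` B)) = 1 - r.
Proof. by rewrite probability_setC// rE. Qed.

(** [A] records which sampled points lie in [B]; over all [A] these boxes partition the samples. *)
Definition side_box k (A : {set 'I_k}) : set (k.-tuple S) :=
  box (fun i => if i \in A then B else ~` B).

Lemma measurable_side_box k (A : {set 'I_k}) : measurable (side_box A).
Proof. by apply: measurable_box => i; case: ifP => // _; exact: measurableC. Qed.

Lemma dens_side_boxes k (F : tournament 'I_k) :
  ((dens W mu F)%:E = \sum_(A : {set 'I_k})
    \int[power_measure mu k]_(x in side_box A) (weight (kw W x) F)%:E)%E.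
Proof.
rewrite densE//.
transitivity (\int[power_measure mu k]_x
    (\sum_(A : {set 'I_k}) weight (kw W x) F * \1_(side_box A) x)%:E)%E.
  apply: eq_integral => x _; congr EFin.
  rewrite -mulr_sumr (bigD1 [set i | `[< B (tnth x i) >]]%SET)//=.
  rewrite indicE mem_set/=; last first.
    by move=> i; rewrite inE; case: asboolP.
  rewrite big1 ?addr0 ?mulr1// => A /eqP AB.
  rewrite indicE memNset// => xA; apply: AB; apply/setP => i; rewrite inE.
  by have := xA i; case: ifP => _ /asboolP; rewrite ?asbool_neg// => /negbTE.
rewrite ge0_integral_bigsum; last 2 first.
- move=> A; apply: measurable_funM; first exact: measurable_weight.
  by apply: measurable_indic; exact: measurable_side_box.
- by move=> A x; rewrite mulr_ge0// weight_ge0.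
apply: eq_bigr => A _; rewrite [RHS]integral_mkcond; apply: eq_integral => x _.
by rewrite patchE indicE; case: ifP => _; rewrite ?mulr1 ?mulr0.
Qed.

Lemma ae_cross k : {ae power_measure mu k, forall x : k.-tuple S, forall i j,
  i != j -> B (tnth x i) -> ~ B (tnth x j) -> W (tnth x i, tnth x j) = 1}.
Proof.
by apply: filterS (ae_pairs k WB) => x h i j ij Bi Bj; apply: h.
Qed.

(** Some edge of [F] goes from outside [A] into [A]. On the box its factor is [W] from the
    complement of [B] to [B], which is almost everywhere 0 because the opposite value is 1. *)
Lemma integral_side_box_cross k (F : tournament 'I_k) (A : {set 'I_k}) :
  ~~ [forall i in A, forall j in ~: A, F i j] ->
  (\int[power_measure mu k]_(x in side_box A) (weight (kw W x) F)%:E = 0)%E.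
Proof.
move=> /forallPn[i]; rewrite negb_imply => /andP[iA /forallPn[j]].
rewrite negb_imply inE => /andP[jA Fij].
have ij : i != j by apply: contraNneq jA => <-.
have Fji : F j i by rewrite tournament_anti// eq_sym.
rewrite (ge0_ae_eq_integral (g := cst 0%E)) ?integral0//.
- exact: measurable_side_box.
- by apply: measurable_funTS; exact: emeasurable_weight.
- by move=> x _; rewrite lee_fin weight_ge0.
apply: filterS (ae_cross k) => x h xA; congr EFin.
rewrite /weight (bigD1 (j, i))//= /kw.
have := W_anti (tnth x i) (tnth x j); rewrite h//.
- move=> /eqP; rewrite -[X in _ == X]addr0 (inj_eq (addrI _)) => /eqP ->.
  by rewrite mul0r.
- by have := xA i; rewrite iA.
- by have := xA j; rewrite (negbTE jA).
Qed.

Lemma mem_image_subtournament k (F : tournament 'I_k) (A : {set 'I_k}) p :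
  (p \in image_edges (subtournament F A) [ffun i => enum_val i]) =
  [&& F p.1 p.2, p.1 \in A & p.2 \in A].
Proof.
case: p => i j; apply/image_edgesP/and3P => /= [[a [b [Fab -> ->]]]|[Fij iA jA]].
  by rewrite !ffunE; split; [exact: Fab|exact: enum_valP|exact: enum_valP].
exists (enum_rank_in iA i), (enum_rank_in iA j); rewrite !ffunE /=.
by rewrite !enum_rankK_in.
Qed.

Lemma weight_subtournament k (F : tournament 'I_k) (A : {set 'I_k}) (x : k.-tuple S) :
  weight (kw W (reindex_tuple (@enum_val _ (mem A)) x)) (subtournament F A) =
  \prod_(p : 'I_k * 'I_k | [&& F p.1 p.2, p.1 \in A & p.2 \in A]) kw W x p.1 p.2.
Proof.
under [RHS]eq_bigl do rewrite -mem_image_subtournament.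
rewrite prod_image_edges; last first.
  by move=> i j; rewrite !ffunE; exact: enum_val_inj.
by apply: eq_bigr => p _; rewrite /kw !tnth_mktuple !ffunE.
Qed.

(** On the box the edges from [A] to its complement have weight 1 almost everywhere, and none go
    back. What remains is a function of the coordinates in [A] times a function of the others, and
    each integral is a density for a conditioned measure. *)
Lemma integral_side_box_split k (F : tournament 'I_k) (A : {set 'I_k}) :
  [forall i in A, forall j in ~: A, F i j] ->
  (\int[power_measure mu k]_(x in side_box A) (weight (kw W x) F)%:E =
   (r ^+ #|A| * (1 - r) ^+ #|~: A| *
    dens W (conditional mu mB) (subtournament F A) *
    dens W (conditional mu (measurableC mB)) (subtournament F (~: A)))%:E)%E.
Proof.
move=> Asplit.
have FA i j : i \in A -> j \notin A -> F i j.
  move=> iA jA; have /forallP/(_ i) := Asplit; rewrite iA/= => /forallP/(_ j).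
  by rewrite inE jA.
pose f1 (y : #|A|.-tuple S) := weight (kw W y) (subtournament F A) * \1_(box (fun=> B)) y.
pose f2 (y : #|~: A|.-tuple S) :=
  weight (kw W y) (subtournament F (~: A)) * \1_(box (fun=> ~` B)) y.
have mbox n C : measurable C -> measurable (box (fun _ : 'I_n => C : set S)).
  by move=> mC; exact: measurable_box.
have mf1 : measurable_fun setT f1.
  apply: measurable_funM; first exact: measurable_weight.
  by apply: measurable_indic; exact: mbox.
have mf2 : measurable_fun setT f2.
  apply: measurable_funM; first exact: measurable_weight.
  by apply: measurable_indic; apply: mbox; exact: measurableC.
have f10 y : 0 <= f1 y by rewrite mulr_ge0// weight_ge0.
have f20 y : 0 <= f2 y by rewrite mulr_ge0// weight_ge0.
transitivity (\int[power_measure mu k]_x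
    (f1 (reindex_tuple (@enum_val _ (mem A)) x) *
     f2 (reindex_tuple (@enum_val _ (mem (~: A))) x))%:E)%E.
  rewrite integral_mkcond; apply: ge0_ae_eq_integral => //.
  - apply/(measurable_restrictT _ _).1; first exact: measurable_side_box.
    by apply: measurable_funTS; exact: emeasurable_weight.
  - apply/measurable_EFinP; apply: measurable_funM;
      [apply: (measurableT_comp mf1)|apply: (measurableT_comp mf2)];
      exact: measurable_reindex_tuple.
  - by move=> x _; rewrite patchE; case: ifP => // _; rewrite lee_fin weight_ge0.
  - by move=> x _; rewrite lee_fin mulr_ge0.
  apply: filterS (ae_cross k) => x h _; rewrite patchE.
  case: ifPn => [/set_mem xA|/negP xA].
    congr EFin; rewrite /f1 /f2 !indicE !mem_set; first last.
    - by move=> i; rewrite tnth_mktuple; have := xA (enum_val i); rewrite enum_valP.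
    - move=> i; rewrite tnth_mktuple; have := xA (enum_val i).
      by have := enum_valP i; rewrite /= finset.in_setC => /negbTE ->.
    rewrite !mulr1 !weight_subtournament /weight big_mkcond/=.
    rewrite [X in _ = X * _]big_mkcond [X in _ = _ * X]big_mkcond -big_split/=.
    apply: eq_bigr => -[i j] _ /=; rewrite !inE.
    case: (boolP (F i j)) => Fij/=; last by rewrite mulr1.
    case: (boolP (i \in A)) => iA; case: (boolP (j \in A)) => jA /=;
      rewrite ?mul1r ?mulr1//.
      rewrite /kw h//; first by apply: contraNneq jA => <-.
      - by have := xA i; rewrite iA.
      - by have := xA j; rewrite (negbTE jA).
    exfalso; have := FA _ _ jA iA; rewrite tournament_anti ?Fij//.
    by apply: contraNneq iA => <-.
  congr EFin; apply/esym/eqP; rewrite /f1 /f2 !indicE mulf_eq0.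
  have [/set_mem x1|] := boolP (_ \in box (fun=> B)); last by rewrite mulr0 eqxx.
  have [/set_mem x2|] := boolP (_ \in box (fun=> ~` B)); last by rewrite mulr0 eqxx orbT.
  exfalso; apply: xA; apply/mem_set => i; case: ifPn => iA.
    by have := x1 (enum_rank_in iA i); rewrite tnth_mktuple enum_rankK_in.
  have iA' : i \in ~: A by rewrite inE.
  by have := x2 (enum_rank_in iA' i); rewrite tnth_mktuple enum_rankK_in.
rewrite integral_power_measure_indep//; last 3 first.
- exact: enum_val_inj.
- exact: enum_val_inj.
- move=> i j; apply: contraTneq (enum_valP i) => ->.
  by have := enum_valP j; rewrite /= finset.in_setC.
have fE n (H : tournament 'I_n) C (mC : measurable C) : (0 < mu C)%E ->
    (\int[power_measure mu n]_y (weight (kw W y) H * \1_(box (fun=> C)) y)%:E =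
     (fine (mu C) ^+ n)%:E * (dens W (conditional mu mC) H)%:E)%E.
  move=> C0; rewrite densE// -integral_power_measure_conditional//; last 2 first.
  - exact: emeasurable_weight.
  - by move=> x; rewrite lee_fin weight_ge0.
  rewrite [RHS]integral_mkcond; apply: eq_integral => y _.
  by rewrite patchE indicE; case: ifP => _; rewrite ?mulr1 ?mulr0.
rewrite (fE _ _ _ mB)// (fE _ _ _ (measurableC mB))// fine_muC -!EFinM.
by congr EFin; rewrite -/r; lra.
Qed.

Lemma dens_oplus k (F : tournament 'I_k) :
  dens W mu F = \sum_(A : {set 'I_k} | [forall i in A, forall j in ~: A, F i j])
     r ^+ #|A| * (1 - r) ^+ #|~: A| *
     dens W (conditional mu mB) (subtournament F A) *
     dens W (conditional mu (measurableC mB)) (subtournament F (~: A)).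
Proof.
apply: EFin_inj; rewrite dens_side_boxes -sumEFin [RHS]big_mkcond; apply: eq_bigr => A _.
by case: ifPn => [/integral_side_box_split|/integral_side_box_cross].
Qed.

Lemma reducible_dens (Gamma : tournament_limit R) :
  (forall k (F : tournament 'I_k), t_ind Gamma F = dens W mu F) ->
  reducible_limit Gamma.
Proof.
move=> GE; exists r.
exists (TournamentLimit (dens_is_limit mW W01 W_anti (conditional mu mB))).
exists (TournamentLimit (dens_is_limit mW W01 W_anti (conditional mu (measurableC mB)))).
split; first by rewrite -!lte_fin -rE.
by move=> k F; rewrite GE dens_oplus.
Qed.

End oplus.

(** * Reducible limits *)

Section limit_densities.
Variables (R : realType) (Gamma : tournament_limit R).

Lemma t_ind_ge0 k (F : tournament 'I_k) : 0 <= t_ind Gamma F.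
Proof.
case: (t_indP Gamma) => v [G [_ _ /(_ k F) tF]].
apply: (cvgr_to_ge tF).
by apply: nearW => m; rewrite /ind_density divr_ge0.
Qed.

Lemma sum_t_ind k : \sum_(F : tournament 'I_k) t_ind Gamma F = 1.
Proof.
case: (t_indP Gamma) => v [G [voo _ tG]].
have c1 : \sum_(F : tournament 'I_k) ind_density R F (G m) @[m --> \oo] -->
    \sum_(F : tournament 'I_k) t_ind Gamma F.
  by apply: cvg_big => [|F _]; [exact: add_continuous|exact: tG].
have c2 : \sum_(F : tournament 'I_k) ind_density R F (G m) @[m --> \oo] --> (1 : R).
  apply: cvg_near_cst; have /cvgnyPge/(_ k) := voo; apply: filterS => m kv.
  rewrite /ind_density -mulr_suml -natr_sum.
  (* For the edgeless digraph every injection counts, so the induced counts of all [F] add up to the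
     number of injections. *)
  have sumE := hom_count_inj (fun _ _ => false) (G m).
  rewrite (_ : (\sum_F ind_count F (G m) = v m ^_ k)%N).
    by rewrite divff// pnatr_eq0 -lt0n ffact_gt0.
  have := card_inj_ffuns 'I_k 'I_(v m); rewrite !card_ord => <-.
  transitivity (\sum_(F : tournament 'I_k | [forall i, forall j, false ==> F i j])
      ind_count F (G m))%N.
    by apply: eq_bigl => F; apply/esym/forallP => i; apply/forallP.
  rewrite -sumE; apply: eq_card => f; rewrite !inE.
  by rewrite (introT forallP) ?andbT// => i; apply/forallP.
exact: (cvg_unique _ c1 c2).
Qed.

End limit_densities.

(** * Gluing two tournaments along a splitting *)

Section glue.
Variables (k : nat) (A : {set 'I_k}).
Variables (F1 : tournament 'I_#|A|) (F2 : tournament 'I_#|~: A|).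

(** This inverts the passage from a tournament split by [A] to its two parts. The existentials
    recover the positions of [i] and [j] in the enumeration of their part. *)
Definition glue_edge (i j : 'I_k) : bool :=
  if i \in A then
    if j \in A then [exists a, exists b, [&& F1 a b, enum_val a == i & enum_val b == j]]
    else true
  else if j \in A then false
    else [exists a, exists b, [&& F2 a b, enum_val a == i & enum_val b == j]].

Lemma exists_enum_val (C : {set 'I_k}) (F : tournament 'I_#|C|) a b :
  [exists a', exists b',
    [&& F a' b', enum_val a' == enum_val a & enum_val b' == enum_val b]]
  = F a b.
Proof.
apply/existsP/idP => [[a' /existsP[b' /and3P[Fab]]]|Fab].
  by move=> /eqP/enum_val_inj <- /eqP/enum_val_inj <-.
by exists a; apply/existsP; exists b; rewrite Fab !eqxx.
Qed.

Lemma glue_is_tournament : is_tournament glue_edge.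
Proof.
have enumE (C : {set 'I_k}) i : i \in C -> exists a : 'I_#|C|, i = enum_val a.
  by move=> iC; exists (enum_rank_in iC i); rewrite enum_rankK_in.
split=> [i|i j ij]; rewrite /glue_edge.
  case: (boolP (i \in A)) => iA.
    by have [a ->] := enumE _ _ iA; rewrite exists_enum_val tournament_irr.
  have iA' : i \in ~: A by rewrite inE.
  by have [a ->] := enumE _ _ iA'; rewrite exists_enum_val tournament_irr.
case: (boolP (i \in A)) => iA; case: (boolP (j \in A)) => jA //.
  have [a ia] := enumE _ _ iA; have [b jb] := enumE _ _ jA.
  rewrite ia jb !exists_enum_val tournament_anti//.
  by apply: contraNneq ij => ab; rewrite ia jb ab.
have iA' : i \in ~: A by rewrite inE.
have jA' : j \in ~: A by rewrite inE.
have [a ia] := enumE _ _ iA'; have [b jb] := enumE _ _ jA'.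
rewrite ia jb !exists_enum_val tournament_anti//.
by apply: contraNneq ij => ab; rewrite ia jb ab.
Qed.

Definition glue := Tournament glue_is_tournament.

Lemma glue_split : [forall i in A, forall j in ~: A, glue i j].
Proof.
apply/forallP => i; apply/implyP => iA; apply/forallP => j; apply/implyP.
by rewrite inE /= /glue_edge iA => /negbTE ->.
Qed.

Lemma subtournament_glueL : subtournament glue A = F1.
Proof.
apply: tournament_ext => a b; rewrite /= /glue_edge.
by rewrite !enum_valP exists_enum_val.
Qed.

Lemma subtournament_glueR : subtournament glue (~: A) = F2.
Proof.
apply: tournament_ext => a b; rewrite /= /glue_edge.
have := enum_valP a; have := enum_valP b.
by rewrite !finset.in_setC => /negbTE -> /negbTE ->; rewrite exists_enum_val.
Qed.

End glue.

Section oplus_split.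
Variables (R : realType) (r : R) (Gamma1 Gamma2 Gamma : tournament_limit R).
Hypothesis r01 : 0 < r < 1.
Hypothesis GE : is_oplus r Gamma1 Gamma2 Gamma.
Variable n : nat.

Let i0 : 'I_n.+2 := ord0.
Let i1 : 'I_n.+2 := lift ord0 ord0.

Definition splits (F : tournament 'I_n.+2) (A : {set 'I_n.+2}) :=
  [forall i in A, forall j in ~: A, F i j].

(** Prescribing the sides of vertices 0 and 1 keeps both parts nonempty for every [n] and names one
    pair for which reachability fails. *)
Definition separated_tournament (F : tournament 'I_n.+2) :=
  [exists A : {set 'I_n.+2}, [&& i0 \in A, i1 \notin A & splits F A]].

(** Every pair of tournaments on the two parts is realized by its gluing, and the products of
    densities over all pairs sum to 1. *)
Lemma sum_splits_ge1 (A : {set 'I_n.+2}) :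
  1 <= \sum_(F | splits F A)
    t_ind Gamma1 (subtournament F A) * t_ind Gamma2 (subtournament F (~: A)).
Proof.
rewrite (partition_big (fun F => (subtournament F A, subtournament F (~: A))) predT)//=.
have <- : \sum_(q : tournament 'I_#|A| * tournament 'I_#|~: A|)
    t_ind Gamma1 q.1 * t_ind Gamma2 q.2 = 1.
  rewrite -(pair_big predT predT (fun a b => t_ind Gamma1 a * t_ind Gamma2 b))/=.
  under eq_bigr do rewrite -mulr_sumr sum_t_ind mulr1.
  exact: sum_t_ind.
apply: ler_sum => -[F1 F2] _ /=; rewrite (bigD1 (glue F1 F2))/=; last first.
  by rewrite /splits glue_split subtournament_glueL subtournament_glueR eqxx.
rewrite subtournament_glueL subtournament_glueR lerDl sumr_ge0// => F _.
by rewrite mulr_ge0// t_ind_ge0.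
Qed.

(** If each vertex joins [A] independently with probability [r], the sum is the probability that 0
    joins and 1 does not. *)
Lemma sum_separating_sets :
  \sum_(A : {set 'I_n.+2} | (i0 \in A) && (i1 \notin A))
    r ^+ #|A| * (1 - r) ^+ #|~: A| = r * (1 - r).
Proof.
(* The forbidden choices get weight 0, so expanding the product of the [a i + b i] leaves exactly
   the separating sets. *)
pose a i := if i == i1 then 0 else r.
pose b i := if i == i0 then 0 else 1 - r.
transitivity (\prod_(i < n.+2) (a i + b i)); last first.
  rewrite (bigD1 i0)//= (bigD1 i1)//= big1 ?mulr1; last first.
    by move=> i /andP[/negbTE i0' /negbTE i1']; rewrite /a /b i0' i1' addrC subrK.
  by rewrite /a /b !eqxx /= addr0 add0r.
rewrite (bigA_distr (1 : R)) [LHS]big_mkcond; apply: eq_bigr => A _.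
case: ifPn => [/andP[A0 A1]|A01].
  rewrite (bigID (mem A))/=; congr (_ * _).
    rewrite -prodr_const; apply: eq_bigr => i iA; rewrite iA /a.
    by case: eqP => // ii1; rewrite -ii1 iA in A1.
  rewrite -prodr_const (eq_bigl (fun i => i \notin A)); last by move=> i; rewrite inE.
  apply: eq_bigr => i iA; rewrite (negbTE iA) /b.
  by case: eqP => // ii0; rewrite ii0 A0 in iA.
apply/esym/eqP; rewrite prodf_seq_eq0; apply/hasP; move: A01; rewrite negb_and negbK.
case/orP => [A0|A1]; [exists i0|exists i1]; rewrite ?mem_index_enum//=.
  by rewrite (negbTE A0) /b eqxx.
by rewrite A1 /a eqxx.
Qed.

(** In the formula for the sum of the two limits, only the sets [A] separating 0 from 1 are kept,
    and the sums over [F] and [A] are exchanged. *)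
Lemma sum_separated : r * (1 - r) <= \sum_(F | separated_tournament F) t_ind Gamma F.
Proof.
have /andP[r0 r1] := r01.
have c0 (A : {set 'I_n.+2}) : 0 <= r ^+ #|A| * (1 - r) ^+ #|~: A|.
  by apply: mulr_ge0; apply: exprn_ge0; rewrite ?subr_ge0 ltW.
have -> : \sum_(F | separated_tournament F) t_ind Gamma F =
    \sum_(F | separated_tournament F) \sum_(A : {set 'I_n.+2} | splits F A)
     r ^+ #|A| * (1 - r) ^+ #|~: A| *
     (t_ind Gamma1 (subtournament F A) * t_ind Gamma2 (subtournament F (~: A))).
  by apply: eq_bigr => F _; rewrite GE; apply: eq_bigr => A _; rewrite mulrA.
apply: (@le_trans _ _ (\sum_(A : {set 'I_n.+2} | (i0 \in A) && (i1 \notin A))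
    r ^+ #|A| * (1 - r) ^+ #|~: A| * \sum_(F | splits F A)
    (t_ind Gamma1 (subtournament F A) * t_ind Gamma2 (subtournament F (~: A))))).
  rewrite -sum_separating_sets; apply: ler_sum => A _.
  by rewrite ler_peMr// sum_splits_ge1.
under eq_bigr do rewrite mulr_sumr.
rewrite (exchange_big_dep separated_tournament)/=; last first.
  by move=> A F /andP[A0 A1] sA; apply/existsP; exists A; rewrite A0 A1.
apply: ler_sum => F _.
rewrite [leRHS](bigID (fun A : {set 'I_n.+2} => (i0 \in A) && (i1 \notin A)))/=.
rewrite (eq_bigl (fun A => splits F A && ((i0 \in A) && (i1 \notin A)))); last first.
  by move=> A; rewrite andbC.
rewrite lerDl sumr_ge0// => A _.
by apply: mulr_ge0; [exact: c0|apply: mulr_ge0; exact: t_ind_ge0].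
Qed.

End oplus_split.

(** * Finite restrictions of G(oo, W) *)

Section realization_law.
Context {R : realType} {d : measure_display} {S : measurableType d}.
Variables (W : S * S -> R) (mu : probability S R).
Hypothesis mW : measurable_fun setT W.
Hypothesis W01 : forall z, 0 <= W z <= 1.
Hypothesis W_anti : forall x y, W (x, y) + W (y, x) = 1.

(** A factor [1 - W] at a pair in increasing order is the value of [W] at the reversed pair, which
    is then the edge of [F]. So finite restrictions of the infinite tournament have the law given by
    [dens]. *)
Lemma edge_prod_weight n (F : tournament 'I_n) (x : n.-tuple S) :
  edge_prod W F x = weight (kw W x) F.
Proof.
rewrite /weight (bigID (fun p : 'I_n * 'I_n => (p.1 < p.2)%N))/=.
rewrite [X in _ = _ * X](_ : _ =
    \prod_(p : 'I_n * 'I_n | ~~ F p.1 p.2 && (p.1 < p.2)%N) kw W x p.2 p.1); last first.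
  rewrite (reindex (fun p : 'I_n * 'I_n => (p.2, p.1)))/=; last first.
    by exists (fun p => (p.2, p.1)) => -[].
  apply: eq_bigl => -[i j] /=; rewrite -leqNgt.
  have [->|ij] := eqVneq i j; first by rewrite tournament_irr ltnn.
  rewrite tournament_anti 1?eq_sym// leq_eqVlt.
  by case: eqP => // /val_inj ij'; rewrite ij' eqxx in ij.
rewrite /edge_prod !(big_mkcond (fun p => _ && _)) -big_split/= big_mkcond/=.
apply: eq_bigr => -[i j] _ /=; case: (i < j)%N; last by rewrite !andbF mulr1.
case: (F i j); rewrite /= ?mulr1 ?mul1r//.
by rewrite /kw -(W_anti (tnth x i) (tnth x j)) addrC addKr.
Qed.

Context {d' : measure_display} {Omega : measurableType d'}.
Variables (P : probability Omega R) (X : nat -> Omega -> S).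
Variable G : Omega -> tournament nat.
Hypothesis hG : is_G_infty mu W P X G.

Definition restr n (om : Omega) : tournament 'I_n := Defs.induced (G om) (@ord_inj n).

Lemma restrE n (F : tournament 'I_n) :
  [set om | restr n om == F] = [set om | forall i j : 'I_n, G om i j = F i j].
Proof.
apply/seteqP; split => om /=; first by move=> /eqP <-.
by move=> h; apply/eqP; apply: tournament_ext => i j; exact: h.
Qed.

Lemma measurable_restr_eq n (F : tournament 'I_n) : measurable [set om | restr n om == F].
Proof.
have [_ mG _] := hG; rewrite restrE.
rewrite (_ : [set om | _] =
    \bigcap_(p in [set: 'I_n * 'I_n]) [set om | G om p.1 p.2 = F p.1 p.2]).
  apply: fin_bigcap_measurable => // p _; case: (F p.1 p.2); first exact: mG.
  rewrite (_ : [set om | _] = ~` [set om | G om p.1 p.2]); first exact/measurableC/mG.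
  by apply/seteqP; split => om /=; [move=> ->|move=> /negP/negbTE].
by apply/seteqP; split => [om h p _|om h i j]; [exact: h|exact: (h (i, j))].
Qed.

Lemma prob_restr_eq n (F : tournament 'I_n) :
  P [set om | restr n om == F] = (dens W mu F)%:E.
Proof.
have [_ _ /(_ n F (fun=> setT) (fun=> measurableT)) PE] := hG.
rewrite restrE densE//.
rewrite (_ : [set om | _] = [set om | (forall i : 'I_n, [set: S] (X i om)) /\
   (forall i j : 'I_n, G om i j = F i j)]); last first.
  by apply/seteqP; split => [om h|om []].
rewrite PE (_ : [set x | _] = setT); last by apply/seteqP; split.
by apply: eq_integral => x _; congr EFin; exact: edge_prod_weight.
Qed.

Lemma measurable_restr n (Q : pred (tournament 'I_n)) :
  measurable [set om | Q (restr n om)].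
Proof.
rewrite (_ : [set om | _] = \bigcup_(F in [set F | Q F]) [set om | restr n om == F]).
  by apply: fin_bigcup_measurable => // F _; exact: measurable_restr_eq.
apply/seteqP; split => [om Qo|om [F /= QF /eqP ->//]].
by exists (restr n om) => /=.
Qed.

Lemma prob_restr n (Q : pred (tournament 'I_n)) :
  P [set om | Q (restr n om)] = (\sum_(F | Q F) dens W mu F)%:E.
Proof.
rewrite -(setIT [set om | _]) -integral_indic//; last exact: measurable_restr.
transitivity (\int[P]_om (\sum_(F | Q F) \1_[set om | restr n om == F] om)%:E)%E.
  apply: eq_integral => om _; congr EFin; rewrite indicE.
  have [/set_mem/= Qo|/negP Qo] := boolP (om \in _).
    rewrite (bigD1 (restr n om))//= indicE mem_set//= big1 ?addr0// => F /andP[_ Fo].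
    by rewrite indicE memNset//= => /eqP oF; rewrite oF eqxx in Fo.
  rewrite big1// => F QF; rewrite indicE memNset//= => /eqP oF.
  by apply: Qo; apply/mem_set; rewrite /= oF.
rewrite ge0_integral_bigsum; last 2 first.
- by move=> F; apply: measurable_indic; exact: measurable_restr_eq.
- by move=> F om; rewrite indicE.
rewrite -sumEFin; apply: eq_bigr => F _.
rewrite integral_indic//; last exact: measurable_restr_eq.
by rewrite setIT; exact: prob_restr_eq.
Qed.

End realization_law.

(** * Unreachable vertices and reducible limits *)

Definition reaches (V : eqType) (H : tournament V) (x y : V) : Prop :=
  exists2 p, path H x p & last x p = y.

Lemma unreachable_reducible (V : eqType) (H : tournament V) x y :
  ~ reaches H x y -> reducible_tournament H.
Proof.
move=> xy; exists [set z | reaches H z y]; split; first by exists y, [::].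
  by exists x.
move=> a b [p pa ay] nb; have [ab|ab] := eqVneq a b.
  by exfalso; apply: nb; rewrite -ab; exists p.
rewrite tournament_anti//; apply/negP => Hba; apply: nb.
by exists (a :: p) => //=; rewrite Hba.
Qed.

(** A path starting outside [A] cannot enter it. The bound on [p] is essential, as the splitting
    controls only the first [n] vertices. *)
Lemma split_unreachable n (H : tournament nat) (A : {set 'I_n}) (x y : 'I_n) p :
  (forall i j : 'I_n, i \in A -> j \notin A -> H i j) ->
  x \notin A -> y \in A -> all (fun z => z < n)%N p -> path H x p ->
  last (x : nat) p <> y.
Proof.
move=> sA; elim: p x => [|z p IH] x xA yA /=.
  by move=> _ _ /val_inj xy; rewrite xy yA in xA.
move=> /andP[zn pn] /andP[xz zp]; apply: (IH (Ordinal zn)) => //=.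
apply/negP => zA; have := sA _ _ zA xA; rewrite /= tournament_anti ?xz//.
by apply: contraTneq xz => ->; rewrite tournament_irr.
Qed.

Lemma reducible_realization (R : realType) (d : measure_display) (S : measurableType d)
    (W : S * S -> R) (mu : probability S R) (Gamma : tournament_limit R) :
  measurable_fun setT W -> (forall z, 0 <= W z <= 1) ->
  (forall x y, W (x, y) + W (y, x) = 1) ->
  (forall k (F : tournament 'I_k), t_ind Gamma F = dens W mu F) ->
  reducible_limit Gamma -> ~ G_infty_as_irreducible mu W.
Proof.
move=> mW W01 W_anti GE [r [G1 [G2 [r01 Gop]]]] irr.
have [d' [Om [P [X [G hG]]]]] := exists_realization mu mW W01.
have [N [mN N0 NE]] := irr _ _ _ _ _ hG.
pose E n := [set om | separated_tournament (restr G n.+2 om)].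
have mE n : measurable (E n) by exact: (measurable_restr hG (@separated_tournament n)).
have PE n : ((r * (1 - r))%:E <= P (E n))%E.
  rewrite (prob_restr mW W01 W_anti hG) lee_fin.
  rewrite (eq_bigr (fun F => t_ind Gamma F)); last by move=> F _; rewrite GE.
  exact: sum_separated r01 Gop n.
(* A splitting restricts to fewer vertices with 0 and 1 still on their sides. Hence the intersection
   of the [E n] keeps probability at least [r * (1 - r)]. *)
have Edec : nonincreasing_seq E.
  apply/nonincreasing_seqP => n; apply/subsetPset => om.
  move=> /existsP[A /and3P[A0 A1 sA]].
  pose w := widen_ord (leqnSn n.+2).
  apply/existsP; exists [set i | w i \in A]%SET; rewrite !inE.
  rewrite (_ : w ord0 = ord0) ?A0/=; last exact: val_inj.
  rewrite (_ : w (lift ord0 ord0) = lift ord0 ord0) ?A1/=; last exact: val_inj.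
  apply/forallP => i; apply/implyP => iA; apply/forallP => j; apply/implyP => jA.
  rewrite !inE in iA jA; have /forallP/(_ (w i)) := sA; rewrite iA/=.
  by move=> /forallP/(_ (w j)); rewrite inE jA.
(* A path from 1 to 0 has finitely many vertices, so it lies inside one restriction, which is split
   with 0 in the first part and 1 in the second. *)
have capE : \bigcap_n E n `<=` N.
  move=> om oE; apply: NE => /=; apply; apply: (@unreachable_reducible _ _ 1%N 0%N).
  move=> [p p1 p0]; pose n := \max_(z <- p) z.
  have /existsP[A /and3P[A0 A1 sA]] := oE n I.
  apply: (@split_unreachable n.+2 (G om) A (lift ord0 ord0) ord0 p) => //.
    move=> i j iA jA; have /forallP/(_ i) := sA; rewrite iA/= => /forallP/(_ j).
    by rewrite inE jA.
  by apply/allP => z zp; rewrite ltnS leqW// /n (big_rem z)//= leq_maxl.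
have mcap : measurable (\bigcap_n E n) by exact: bigcapT_measurable.
have P0 : P (\bigcap_n E n) = 0%E.
  by apply/eqP; rewrite eq_le measure_ge0 andbT -N0 le_measure// inE.
have cE : P (E n) @[n --> \oo] --> 0%E.
  rewrite -P0; apply: nonincreasing_cvg_mu => //.
  by rewrite -ge0_fin_numE// fin_num_measure.
have : ((r * (1 - r))%:E <= 0)%E.
  by apply: (cvge_to_ge cE); apply: nearW => n; exact: PE.
by rewrite lee_fin leNgt mulr_gt0//; case/andP: r01 => // r0; rewrite subr_gt0.
Qed.

(** * Chains in an irreducible kernel *)

Section ae_sections.
Context {R : realType} {d1 d2 : measure_display}.
Context {T1 : measurableType d1} {T2 : measurableType d2}.
Variables (m1 : probability T1 R) (m2 : probability T2 R).

Lemma ae_prod_sections (Q : set (T1 * T2)) : measurable Q ->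
  {ae m2, forall y, {ae m1, forall x, Q (x, y)}} -> {ae (m1 \x m2)%E, forall z, Q z}.
Proof.
move=> mQ hQ; exists (~` Q); split => //; first exact: measurableC.
have mQC : measurable (~` Q) by exact: measurableC.
have mI : measurable_fun setT (fun z => (\1_(~` Q) z : R)%:E).
  by apply/measurable_EFinP; exact: measurable_indic.
have I0 z : (0 <= (\1_(~` Q) z : R)%:E)%E by rewrite lee_fin indicE.
rewrite -(setIT (~` Q)) -integral_indic//.
rewrite (fubini_tonelli2 (fun z => (\1_(~` Q) z : R)%:E) mI I0).
rewrite -[RHS](integral0 m2 setT); apply: ge0_ae_eq_integral => //.
- exact: measurable_fun_fubini_tonelli_G.
- by move=> y _; apply: integral_ge0 => x _; exact: I0.
apply: filterS hQ => y hy _; rewrite /fubini_G -[RHS](integral0 m1 setT).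
apply: ge0_ae_eq_integral => //.
- exact: (measurableT_comp mI (pair2_measurable y)).
by apply: filterS hy => x Qx _; rewrite indicE memNset//=.
Qed.

End ae_sections.

Section chains.
Context {R : realType} {d : measure_display} {S : measurableType d}.
Variables (W : S * S -> R) (mu : probability S R).
Hypothesis mW : measurable_fun setT W.
Hypothesis W01 : forall z, 0 <= W z <= 1.
Hypothesis W_anti : forall x y, W (x, y) + W (y, x) = 1.

(* The probability that k fresh vertices z1, ..., zk carry the directed path
   x -> z1 -> ... -> zk -> y in G(oo, W). *)
Fixpoint chain k (x y : S) : R :=
  if k is k'.+1 then fine (\int[mu]_z (W (x, z) * chain k' z y)%:E)%E
  else W (x, y).

(** The two claims share one induction: the bounds on the previous chain make the next integral
    finite and nonnegative, and Tonelli makes it measurable. *)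
Lemma chain01_measurable k : (forall x y, 0 <= chain k x y <= 1) /\
  measurable_fun setT (fun z : S * S => chain k z.1 z.2).
Proof.
elim: k => [|k [IH01 IHm]] /=.
  by split=> //; rewrite (_ : (fun _ => _) = W)//; apply/funext => -[].
have mint : measurable_fun setT
    (fun q : (S * S) * S => W (q.1.1, q.2) * chain k q.2 q.1.2).
  apply: measurable_funM.
    apply: (measurableT_comp mW); apply: measurable_fun_pair => //.
    exact: measurableT_comp.
  have mp : measurable_fun setT (fun q : (S * S) * S => (q.2, q.1.2)).
    by apply: measurable_fun_pair => //; exact: measurableT_comp.
  exact: (measurableT_comp IHm mp).
have int01 x y z : 0 <= W (x, z) * chain k z y <= 1.
  have /andP[W0 W1] := W01 (x, z); have /andP[c0 c1] := IH01 z y.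
  by rewrite mulr_ge0//= mulr_ile1.
split => [x y|].
  rewrite fine_ge0 /=; last first.
    by apply: integral_ge0 => z _; rewrite lee_fin; case/andP: (int01 x y z).
  rewrite -lee_fin fineK; last first.
    apply: integral_unit_fin_num => //.
    exact: (measurableT_comp mint (pair1_measurable (x, y))).
  rewrite -(probability_setT mu) -[leRHS]mul1e -integral_cst//.
  apply: ge0_le_integral => //.
  - by move=> z _; rewrite lee_fin; case/andP: (int01 x y z).
  - apply/measurable_EFinP.
    exact: (measurableT_comp mint (pair1_measurable (x, y))).
  - by move=> z _; rewrite lee_fin; case/andP: (int01 x y z).
apply: measurableT_comp => //.
apply: (measurable_fun_fubini_tonelli_F
  (fun q : (S * S) * S => (W (q.1.1, q.2) * chain k q.2 q.1.2)%:E)).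
  exact/measurable_EFinP.
by move=> [[x y] z]; rewrite lee_fin; case/andP: (int01 x y z).
Qed.

Lemma chain01 k x y : 0 <= chain k x y <= 1.
Proof. by have [] := chain01_measurable k. Qed.

Lemma chain_ge0 k x y : 0 <= chain k x y.
Proof. by case/andP: (chain01 k x y). Qed.

Lemma measurable_chain k : measurable_fun setT (fun z : S * S => chain k z.1 z.2).
Proof. by have [] := chain01_measurable k. Qed.

Lemma chain_step01 k x y z : 0 <= W (x, z) * chain k z y <= 1.
Proof.
have /andP[W0 W1] := W01 (x, z); have /andP[c0 c1] := chain01 k z y.
by rewrite mulr_ge0//= mulr_ile1.
Qed.

Lemma measurable_W1 x : measurable_fun setT (fun z => W (x, z)).
Proof. exact: (measurableT_comp mW (pair1_measurable x)). Qed.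

Lemma measurable_W2 y : measurable_fun setT (fun z => W (z, y)).
Proof. exact: (measurableT_comp mW (pair2_measurable y)). Qed.

Lemma measurable_chain1 k y : measurable_fun setT (fun z => chain k z y).
Proof. exact: (measurableT_comp (measurable_chain k) (pair2_measurable y)). Qed.

Lemma measurable_chain_step k x y : measurable_fun setT (fun z => W (x, z) * chain k z y).
Proof. by apply: measurable_funM; [exact: measurable_W1|exact: measurable_chain1]. Qed.

Lemma chainS k x y :
  ((chain k.+1 x y)%:E = \int[mu]_z (W (x, z) * chain k z y)%:E)%E.
Proof.
rewrite fineK//; apply: integral_unit_fin_num; first exact: measurable_chain_step.
by move=> z; exact: chain_step01.
Qed.

Lemma ae_eq0 (f : S -> R) : measurable_fun setT f -> (forall x, 0 <= f x) ->
  (\int[mu]_x (f x)%:E = 0)%E -> {ae mu, forall x, f x = 0}.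
Proof.
move=> mf f0 If0.
have /ae_eq_integral_abs : (\int[mu]_x `|(f x)%:E| = 0)%E.
  by rewrite -[RHS]If0; apply: eq_integral => x _; rewrite /= ger0_norm.
move=> /(_ measurableT) h.
by apply: filterS (h _) => [x /(_ I) [->//]|]; exact/measurable_EFinP.
Qed.

(** The index [k.+1] demands at least one interior vertex: fresh vertices permit repeated attempts,
    while the direct edge can be tried only once. *)
Definition ancestors (y : S) : set S := [set x | exists k, 0 < chain k.+1 x y].

Lemma measurable_gt0_set d' (T : measurableType d') (f : T -> R) :
  measurable_fun setT f -> measurable [set x | 0 < f x].
Proof.
move=> mf; rewrite -[X in measurable X]setTI.
rewrite (_ : [set x | 0 < f x] = f @^-1` `]0, +oo[%classic).
  exact: mf.
by apply/seteqP; split => x /=; rewrite in_itv/= andbT.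
Qed.

Lemma measurable_linked :
  measurable [set z : S * S | exists k, 0 < chain k.+1 z.1 z.2].
Proof.
rewrite (_ : [set z | _] = \bigcup_k [set z : S * S | 0 < chain k.+1 z.1 z.2]).
  by apply: bigcupT_measurable => k; apply: measurable_gt0_set; exact: measurable_chain.
by apply/seteqP; split => z /= [k]; [exists k|exists k].
Qed.

Lemma measurable_ancestors y : measurable (ancestors y).
Proof.
have := pair2_measurable y measurableT measurable_linked.
by rewrite setTI.
Qed.

(** For each [k] the integral of [W (x, z) * chain k.+1 z y] is a longer chain from [x], hence 0. So
    [W (x, z)] vanishes for almost every ancestor [z], and antisymmetry reverses this to 1. *)
Lemma ancestors_closed x y : ~ ancestors y x ->
  {ae mu, forall z, ancestors y z -> W (z, x) = 1}.
Proof.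
move=> nx.
have h k : {ae mu, forall z, W (x, z) * chain k z y = 0}.
  apply: ae_eq0; first exact: measurable_chain_step.
    by move=> z; case/andP: (chain_step01 k x y z).
  rewrite -chainS; congr EFin; apply/eqP; rewrite eq_le chain_ge0 andbT leNgt.
  by apply/negP => c0; apply: nx; exists k.
apply: filterS (ae_foralln h) => z hz [k zy].
have /eqP := hz k.+1; rewrite mulf_eq0 (gt_eqF zy) orbF => /eqP Wxz.
by rewrite -(W_anti x z) Wxz add0r.
Qed.

Hypothesis irr : irreducible_kernel mu W.

Lemma ancestors_01 y : mu (ancestors y) = 0%E \/ mu (ancestors y) = 1%E.
Proof.
have mA := measurable_ancestors y.
have [->|A0] := eqVneq (mu (ancestors y)) 0%E; [by left|right].
apply/eqP; apply/negPn/negP => A1; apply: irr.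
exists (ancestors y); split => //.
  by rewrite lt0e A0 measure_ge0/= lt_neqAle A1 probability_le1.
have mQ : measurable [set z : S * S | (ancestors y `*` ~` ancestors y) z -> W z = 1].
  rewrite (_ : [set z | _] = ~` (ancestors y `*` ~` ancestors y) `|` W @^-1` [set 1]).
    apply: measurableU.
      by apply: measurableC; apply: measurableX => //; exact: measurableC.
    by rewrite -[X in measurable X]setTI; exact: mW.
  apply/seteqP; split => z /=; last by move=> [].
  by have [|] := pselect ((ancestors y `*` ~` ancestors y) z); [right|left]; auto.
apply: (ae_prod_sections mQ); apply: aeW => x.
have [xy|xy] := pselect (ancestors y x); first by apply: aeW => z [].
by apply: filterS (ancestors_closed xy) => z h [zy _]; exact: h.
Qed.

Let indeg y : \bar R := (\int[mu]_x (W (x, y))%:E)%E.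

Lemma measurable_indeg : measurable_fun setT indeg.
Proof.
apply: (measurable_fun_fubini_tonelli_G (fun z => (W z)%:E)).
  exact/measurable_EFinP.
by move=> z; rewrite lee_fin; case/andP: (W01 z).
Qed.

Lemma indeg_ge0 y : (0 <= indeg y)%E.
Proof. by apply: integral_ge0 => x _; rewrite lee_fin; case/andP: (W01 (x, y)). Qed.

(* On the set N of points of in-degree 0, W and its transpose both vanish a.e.
   while they sum to 1, so mu(N)^2 = 0. *)
Lemma indeg_gt0 : {ae mu, forall y, (0 < indeg y)%E}.
Proof.
pose N := [set y | indeg y = 0%E].
have mN : measurable N.
  by have := measurable_indeg measurableT (emeasurable_set1 0%E); rewrite setTI.
suff N0 : mu N = 0%E.
  exists N; split => // y /= /negP; rewrite -leNgt => y0.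
  by apply/eqP; rewrite eq_le y0 indeg_ge0.
have W0 z : (0 <= (W z)%:E)%E by rewrite lee_fin; case/andP: (W01 z).
have mWE : measurable_fun setT (fun z => (W z)%:E) by exact/measurable_EFinP.
have ae0 : {ae (mu \x mu)%E, forall z, N z.2 -> W z = 0}.
  have mQ : measurable [set z : S * S | N z.2 -> W z = 0].
    rewrite (_ : [set z | _] = snd @^-1` (~` N) `|` W @^-1` [set 0]).
      apply: measurableU; rewrite -[X in measurable X]setTI.
        by apply: measurable_snd => //; exact: measurableC.
      exact: mW.
    apply/seteqP; split => z /=; last by move=> [].
    by have [|] := pselect (N z.2); [right|left]; auto.
  apply: (ae_prod_sections mQ); apply: aeW => y.
  have [Ny|Ny] := pselect (N y); last by apply: aeW => x.
  have := ae_eq0 (measurable_W2 y) _ Ny.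
  move=> /(_ (fun x => proj1 (andP (W01 (x, y))))).
  by apply: filterS => x h _.
pose sw (z : S * S) := (z.2, z.1).
have msw : measurable_fun setT sw by exact: measurable_fun_pair.
have ae1 : {ae (mu \x mu)%E, forall z, ~ (N `*` N) z}.
  have swap : {ae (mu \x mu)%E, forall z, N z.1 -> W (z.2, z.1) = 0}.
    have [M [mM M0 MQ]] := ae0; exists (sw @^-1` M); split.
    - by rewrite -[X in measurable X]setTI; exact: msw.
    - rewrite -M0 -[X in _ = (_ \x _)%E X]setIT -(setIT (_ @^-1` _)).
      rewrite -!integral_indic//; last first.
        by rewrite -[X in measurable X]setTI; exact: msw.
      have ms : measurable_fun setT (fun z => (\1_M z : R)%:E).
        by apply/measurable_EFinP; exact: measurable_indic.
      have M1 z : (0 <= (\1_M z : R)%:E)%E by rewrite lee_fin indicE.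
      (* The set and its mirror image are measured by iterated integrals in opposite orders, which
         coincide. *)
      rewrite (fubini_tonelli2 (fun z => (\1_M z : R)%:E) ms M1).
      rewrite (fubini_tonelli1 (fun z => (\1_(sw @^-1` M) z : R)%:E))//.
      by apply: (measurableT_comp ms); exact: msw.
    - by move=> z /= h; apply: MQ => /= h'; apply: h => Nz; exact: h'.
  apply: filterS2 ae0 swap => -[x y] /= h1 h2 [Nx Ny].
  by have := W_anti x y; rewrite h1// h2// addr0 => /eqP; rewrite eq_sym oner_eq0.
have NN0 : (mu \x mu)%E (N `*` N) = 0%E.
  apply/negligibleP; first exact: measurableX.
  have [M [mM M0 MQ]] := ae1; exists M; split => //.
  by move=> z Nz; apply: MQ => /=; apply.
move: NN0; rewrite product_measure1E// => /eqP; rewrite mule_eq0 => /orP[] /eqP//.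
Qed.

(** If almost nothing were an ancestor of [y], the chains with one interior vertex would integrate
    to 0. By Tonelli so would [indeg z * W (z, y)], and since [indeg] is almost everywhere positive,
    [y] would have in-degree 0. *)
Lemma ae_linked : {ae (mu \x mu)%E, forall z, exists k, 0 < chain k.+1 z.1 z.2}.
Proof.
apply: (ae_prod_sections measurable_linked).
apply: filterS indeg_gt0 => y y0.
have mA := measurable_ancestors y.
have [A0|A1] := ancestors_01 y; last first.
  exists (~` ancestors y); split => //; first exact: measurableC.
  by rewrite probability_setC// A1 subee.
exfalso.
have W0 z : 0 <= W z by case/andP: (W01 z).
have c1 : (\int[mu]_x (chain 1 x y)%:E = 0)%E.
  rewrite -[RHS](integral0 mu setT); apply: ge0_ae_eq_integral => //.
  - by apply/measurable_EFinP; exact: measurable_chain1.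
  - by move=> x _; rewrite lee_fin chain_ge0.
  exists (ancestors y); split => // x /= h; exists 0%N.
  rewrite lt0r chain_ge0 andbT; apply/eqP => c0; apply: h => _.
  by rewrite /= in c0; rewrite c0.
have mf : measurable_fun setT (fun q : S * S => (W q * W (q.2, y))%:E).
  apply/measurable_EFinP; apply: measurable_funM => //.
  apply: (measurableT_comp (measurable_W2 y)); exact: measurable_snd.
have f0 (q : S * S) : (0 <= (W q * W (q.2, y))%:E)%E by rewrite lee_fin mulr_ge0.
have c2 : (\int[mu]_z (indeg z * (W (z, y))%:E) = 0)%E.
  rewrite -[RHS]c1.
  transitivity (\int[mu]_x \int[mu]_z (W (x, z) * W (z, y))%:E)%E; last first.
    by apply: eq_integral => x _; rewrite chainS.
  rewrite (fubini_tonelli (fun q : S * S => (W q * W (q.2, y))%:E))//.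
  apply: eq_integral => z _ /=; rewrite muleC /indeg -ge0_integralZl_EFin//.
  - by apply: eq_integral => x _; rewrite -EFinM mulrC.
  - by move=> x _; rewrite lee_fin.
  - by apply/measurable_EFinP; exact: measurable_W2.
have ae2 : {ae mu, forall z, W (z, y) = 0}.
  have : {ae mu, forall z, setT z -> (indeg z * (W (z, y))%:E = 0)%E}.
    apply/ae_eq_integral_abs => //.
      apply: emeasurable_funM; first exact: measurable_indeg.
      by apply/measurable_EFinP; exact: measurable_W2.
    rewrite -[RHS]c2; apply: eq_integral => z _.
    by rewrite gee0_abs// mule_ge0 ?indeg_ge0// lee_fin.
  apply: filterS2 indeg_gt0 => z z0 /(_ I)/eqP; rewrite mule_eq0 (gt_eqF z0)/=.
  by rewrite eqe => /eqP.
suff iy : indeg y = 0%E by rewrite iy ltxx in y0.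
rewrite /indeg -[RHS](integral0 mu setT); apply: ge0_ae_eq_integral => //.
- by apply/measurable_EFinP; exact: measurable_W2.
- by move=> x _; rewrite lee_fin.
by apply: filterS ae2 => z -> _.
Qed.

End chains.

(** * Disjoint paths *)

Section path_edges.
Variable V : eqType.
Implicit Types (a j : V) (b : seq V) (p q : V * V).

Fixpoint path_edges a b j : seq (V * V) :=
  if b is v :: b' then (a, v) :: path_edges v b' j else [:: (a, j)].

Lemma path_edges_mem a b j p : p \in path_edges a b j ->
  p.1 \in a :: b /\ p.2 \in rcons b j.
Proof.
elim: b a => [|v b IH] a /=.
  by rewrite (mem_seq1 p) => /eqP ->; rewrite /= !inE !eqxx.
rewrite (in_cons _ _ p) => /orP[/eqP ->/=|/IH[]]; first by rewrite !inE !eqxx.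
by rewrite !inE => -> ->; rewrite !orbT.
Qed.

Lemma all_path_edges (H : rel V) a b j :
  all (fun p => H p.1 p.2) (path_edges a b j) = path H a (rcons b j).
Proof. by elim: b a => [|v b IH] a //=; rewrite IH. Qed.

(** Different as unordered pairs. Together with the absence of loops this yields the hypotheses of
    [sum_extensions_avoid], in a form that passes through concatenation. *)
Definition distinct_edges p q := (p != q) && (p != (q.2, q.1)).

Lemma distinct_edgesP E : pairwise distinct_edges E -> all (fun p => p.1 != p.2) E ->
  uniq E /\ {in E, forall p, (p.2, p.1) \notin E}.
Proof.
move=> dE iE; split.
  by rewrite uniq_pairwise; apply: sub_pairwise dE => p q /andP[].
elim: E dE iE => // e E IH /=; move=> /andP[/allP de dE] /andP[e12 iE] p.
rewrite !inE negb_or => /orP[/eqP ->|pE].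
  apply/andP; split.
    by apply: contra e12 => /eqP/(congr1 fst)/= ->.
  by apply/negP => /de /andP[_]; rewrite -surjective_pairing eqxx.
rewrite (IH dE iE _ pE) andbT.
by have /andP[_] := de _ pE; rewrite eq_sym.
Qed.

Lemma path_edges_distinct a b j : uniq (a :: rcons b j) ->
  pairwise distinct_edges (path_edges a b j) &&
  all (fun p => p.1 != p.2) (path_edges a b j).
Proof.
elim: b a => [|v b IH] a /=.
  by rewrite inE !andbT.
move=> /andP[]; rewrite inE negb_or => /andP[av ab] u.
have /andP[-> ->] := IH v u; rewrite av !andbT.
apply/allP => q /path_edges_mem[q1 q2]; apply/andP; split.
  apply: contraNneq av => aq; move: q1; rewrite -aq/= inE => /orP[//|ab'].
  by move: ab; rewrite mem_rcons inE negb_or ab' andbF.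
by apply: contraNneq ab => aq; move: q2; rewrite -[q.2]/((q.2, q.1).1) -aq.
Qed.

(** The paths share only their endpoints. A path with nonempty interior does not use the edge from
    [i] to [j], so each of its edges touches its own block, which no other path meets. *)
Lemma flatten_path_edges_distinct i j (bs : seq (seq V)) :
  all (fun b => b != [::]) bs -> uniq (i :: j :: flatten bs) ->
  pairwise distinct_edges (flatten [seq path_edges i b j | b <- bs]) &&
  all (fun p => p.1 != p.2) (flatten [seq path_edges i b j | b <- bs]).
Proof.
elim: bs => //= b bs IH /andP[b0 bs0].
rewrite !inE !negb_or !mem_cat !negb_or cat_uniq => /andP[/andP[ij /andP[ib ibs]]].
move=> /andP[/andP[jb jbs] /and3P[ub bbs ubs]].
have /andP[IH1 IH2] :
    pairwise distinct_edges (flatten [seq path_edges i b j | b <- bs]) &&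
    all (fun p => p.1 != p.2) (flatten [seq path_edges i b j | b <- bs]).
  by apply: IH => //; rewrite !inE !negb_or ij ibs jbs.
have pb : pairwise distinct_edges (path_edges i b j) &&
  all (fun p => p.1 != p.2) (path_edges i b j).
  by apply: path_edges_distinct; rewrite /= mem_rcons inE negb_or ij ib rcons_uniq jb ub.
have /andP[pb1 pb2] := pb.
rewrite pairwise_cat all_cat pb1 pb2 IH1 IH2 !andbT.
have touch p : p \in path_edges i b j -> (p.1 \in b) || (p.2 \in b).
  case: b b0 {ib jb ub bbs pb pb1 pb2} => // v b _ /=.
  rewrite (in_cons _ _ p) => /orP[/eqP ->|/path_edges_mem[-> _]//].
  by rewrite /= !inE eqxx orbT.
apply/allrelP => p q /touch tp /flattenP[_ /mapP[b' b'bs ->] /path_edges_mem[q1 q2]].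
have outside z : z \in b -> z \notin i :: b' /\ z \notin rcons b' j.
  move=> zb; have zb' : z \notin b'.
    apply/negP => zb'; move/hasPn: bbs => /(_ z); rewrite zb => h.
    by have /h : z \in flatten bs by apply/flattenP; exists b'.
  rewrite mem_rcons !inE !negb_or zb' !andbT; split.
    by apply: contraNneq ib => <-.
  by apply: contraNneq jb => <-.
apply/andP; split; apply/eqP => pq; move: tp; rewrite pq => /orP[] /outside[].
- by rewrite q1.
- by rewrite q2.
- by rewrite q2.
- by rewrite q1.
Qed.

End path_edges.

Fixpoint blocks (L : nat) (ks : seq nat) : seq (seq nat) :=
  if ks is k :: ks' then iota L k :: blocks (L + k) ks' else [::].

Lemma flatten_blocks L ks : flatten (blocks L ks) = iota L (sumn ks).
Proof. by elim: ks L => //= k ks IH L; rewrite IH iotaD. Qed.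

Lemma blocks_neq0 L ks :
  all (fun k => 0 < k)%N ks -> all (fun b => b != [::]) (blocks L ks).
Proof.
elim: ks L => //= k ks IH L /andP[k0 ks0]; rewrite IH// andbT.
by case: k k0.
Qed.

Section path_weights.
Context {R : realType} {d : measure_display} {S : measurableType d}.
Variables (W : S * S -> R) (mu : probability S R).
Hypothesis mW : measurable_fun setT W.
Hypothesis W01 : forall z, 0 <= W z <= 1.

Fixpoint path_weight (x : S) (s : seq S) (y : S) : R :=
  if s is z :: s' then W (x, z) * path_weight z s' y else W (x, y).

Lemma prod_path_edges (V : eqType) (f : V -> S) a b j :
  \prod_(p <- path_edges a b j) W (f p.1, f p.2) = path_weight (f a) (map f b) (f j).
Proof.
elim: b a => [|v b IH] a /=; first by rewrite big_seq1.
by rewrite big_cons IH.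
Qed.

Lemma path_weight01 x s y : 0 <= path_weight x s y <= 1.
Proof.
elim: s x => [|z s IH] x /=; first exact: W01.
have /andP[W0 W1] := W01 (x, z); have /andP[p0 p1] := IH z.
by rewrite mulr_ge0//= mulr_ile1.
Qed.

Lemma measurable_path_weight k y :
  measurable_fun setT (fun q : S * k.-tuple S => path_weight q.1 q.2 y).
Proof.
elim: k => [|k IH].
  rewrite (_ : (fun _ => _) = (fun q : S * 0.-tuple S => W (q.1, y))).
    exact: (measurableT_comp (measurable_W2 mW y) measurable_fst).
  by apply/funext => -[x t]; rewrite /= tuple0.
have m0 : measurable_fun setT (fun q : S * k.+1.-tuple S => tnth q.2 ord0).
  exact: (measurableT_comp (measurable_tnth ord0) measurable_snd).
have mb : measurable_fun setT (fun q : S * k.+1.-tuple S => [tuple of behead q.2]).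
  exact: (measurableT_comp (@measurable_behead _ S k) measurable_snd).
rewrite (_ : (fun _ => _) = (fun q : S * k.+1.-tuple S => W (q.1, tnth q.2 ord0) *
    path_weight (tnth q.2 ord0) [tuple of behead q.2] y)).
  apply: measurable_funM.
    by apply: (measurableT_comp mW); exact: measurable_fun_pair.
  exact: (measurableT_comp IH (measurable_fun_pair m0 mb)).
by apply/funext => -[x t]; case/tupleP: t => z t; rewrite !(tnth_nth z).
Qed.

Lemma measurable_path_weight1 k x y :
  measurable_fun setT (fun t : k.-tuple S => path_weight x t y).
Proof. exact: (measurableT_comp (@measurable_path_weight k y) (pair1_measurable x)). Qed.

Lemma integral_path_weight k x y :
  (\int[power_measure mu k]_t (path_weight x t y)%:E = (chain W mu k x y)%:E)%E.
Proof.
elim: k x => [|k IH] x.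
  rewrite /= integral_dirac//= ?diracT ?mul1e//.
  by apply/measurable_EFinP; exact: measurable_path_weight1.
rewrite integral_power_measureS; last 2 first.
- by apply/measurable_EFinP; exact: measurable_path_weight1.
- by move=> t; rewrite lee_fin; case/andP: (path_weight01 x t y).
rewrite chainS//; apply: eq_integral => z _ /=.
under eq_integral do rewrite EFinM.
rewrite ge0_integralZl_EFin ?IH//.
- by move=> t _; rewrite lee_fin; case/andP: (path_weight01 z t y).
- by apply/measurable_EFinP; exact: measurable_path_weight1.
- by case/andP: (W01 (x, z)).
Qed.

Lemma integral_path_weightC k x y :
  (\int[power_measure mu k]_t (1 - path_weight x t y)%:E = (1 - chain W mu k x y)%:E)%E.
Proof.
have mp := @measurable_path_weight1 k x y.
have : (\int[power_measure mu k]_t (1 - path_weight x t y)%:E +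
        \int[power_measure mu k]_t (path_weight x t y)%:E = 1)%E.
  rewrite -ge0_integralD//; last 4 first.
  - by move=> t _; rewrite lee_fin subr_ge0; case/andP: (path_weight01 x t y).
  - by apply/measurable_EFinP; exact: measurable_funB.
  - by move=> t _; rewrite lee_fin; case/andP: (path_weight01 x t y).
  - exact/measurable_EFinP.
  under eq_integral do rewrite -EFinD subrK.
  by rewrite integral_cst//= probability_setT mul1e.
rewrite integral_path_weight => h.
by rewrite EFinB -h addeK.
Qed.

(** Given endpoint types [x] and [y] and the types [t] of the fresh vertices, this is the
    probability that all attempts fail; each attempt consumes the next block of [t]. *)
Fixpoint avoid_weight (x y : S) (ks : seq nat) (t : seq S) : R :=
  if ks is k :: ks' then
    (1 - path_weight x (take k t) y) * avoid_weight x y ks' (drop k t)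
  else 1.

Lemma avoid_weight_ge0 x y ks t : 0 <= avoid_weight x y ks t.
Proof.
elim: ks t => //= k ks IH t; rewrite mulr_ge0// subr_ge0.
by case/andP: (path_weight01 x (take k t) y).
Qed.

Lemma take_reindex k m (t : (k + m).-tuple S) :
  take k t = reindex_tuple (lshift m) t :> seq S.
Proof.
apply: (@eq_from_nth _ point); first by rewrite size_takel !size_tuple ?leq_addr.
move=> i; rewrite size_takel ?size_tuple ?leq_addr// => ik'.
rewrite nth_take//.
by rewrite -[i in RHS]/(val (Ordinal ik')) -tnth_nth tnth_mktuple (tnth_nth point).
Qed.

Lemma drop_reindex k m (t : (k + m).-tuple S) :
  drop k t = reindex_tuple (@rshift k m) t :> seq S.
Proof.
apply: (@eq_from_nth _ point); first by rewrite size_drop !size_tuple addKn.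
move=> i; rewrite size_drop size_tuple addKn => im'.
rewrite nth_drop.
by rewrite -[i in RHS]/(val (Ordinal im')) -tnth_nth tnth_mktuple (tnth_nth point).
Qed.

Lemma measurable_avoid_weight x y ks :
  measurable_fun setT (fun t : (sumn ks).-tuple S => avoid_weight x y ks t).
Proof.
elim: ks => [|k ks IH] //.
rewrite (_ : (fun _ => _) = (fun t : (k + sumn ks).-tuple S =>
   (1 - path_weight x (reindex_tuple (lshift (sumn ks)) t) y) *
   avoid_weight x y ks (reindex_tuple (@rshift k (sumn ks)) t))); last first.
  by apply/funext => t; rewrite -take_reindex -drop_reindex.
apply: measurable_funM.
  apply: measurable_funB => //.
  exact: (measurableT_comp (@measurable_path_weight1 k x y) (measurable_reindex_tuple _)).
exact: (measurableT_comp IH (measurable_reindex_tuple _)).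
Qed.

Lemma integral_avoid_weight x y ks :
  (\int[power_measure mu (sumn ks)]_t (avoid_weight x y ks t)%:E =
   (\prod_(k <- ks) (1 - chain W mu k x y))%:E)%E.
Proof.
elim: ks => [|k ks IH].
  by rewrite /= big_nil integral_cst//= diracT mul1e.
have mA : measurable_fun setT (fun t : (k + sumn ks).-tuple S =>
  avoid_weight x y (k :: ks) t) := @measurable_avoid_weight x y (k :: ks).
rewrite (@integral_power_measure_cat _ _ _ mu k (sumn ks)
   (fun t => (avoid_weight x y (k :: ks) t)%:E)); last 2 first.
- by apply/measurable_EFinP; exact: mA.
- by move=> t; rewrite lee_fin avoid_weight_ge0.
set c := \prod_(k <- ks) (1 - chain W mu k x y).
have c0 : 0 <= c.
  by apply: prodr_ge0 => k' _; rewrite subr_ge0; case/andP: (chain01 mu mW W01 k' x y).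
transitivity (\int[power_measure mu k]_s (c%:E * (1 - path_weight x s y)%:E))%E.
  apply: eq_integral => s _ /=.
  have p0 : 0 <= 1 - path_weight x s y.
    by rewrite subr_ge0; case/andP: (path_weight01 x s y).
  under eq_integral => t _.
    rewrite take_size_cat ?size_tuple// drop_size_cat ?size_tuple// EFinM.
    over.
  rewrite ge0_integralZl_EFin ?IH// 1?muleC//.
  - by move=> t _; rewrite lee_fin avoid_weight_ge0.
  - by apply/measurable_EFinP; exact: measurable_avoid_weight.
rewrite ge0_integralZl_EFin//; last 2 first.
- by move=> s _; rewrite lee_fin subr_ge0; case/andP: (path_weight01 x s y).
- apply/measurable_EFinP; apply: measurable_funB => //.
  exact: measurable_path_weight1.
by rewrite integral_path_weightC -EFinM big_cons mulrC.
Qed.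

Lemma prod_blocks x y L ks (t : seq S) : size t = (L + sumn ks)%N ->
  \prod_(b <- blocks L ks) (1 - path_weight x (map (nth point t) b) y) =
  avoid_weight x y ks (drop L t).
Proof.
elim: ks L => [|k ks IH] L /= st; first by rewrite big_nil.
rewrite big_cons IH; last by rewrite st addnA.
by rewrite map_nth_iota; [rewrite drop_drop addnC|rewrite st; lia].
Qed.

End path_weights.

(** * Almost sure reachability *)

Section reachability.
Context {R : realType} {d : measure_display} {S : measurableType d}.
Variables (W : S * S -> R) (mu : probability S R).
Hypothesis mW : measurable_fun setT W.
Hypothesis W01 : forall z, 0 <= W z <= 1.
Hypothesis W_anti : forall x y, W (x, y) + W (y, x) = 1.
Context {d' : measure_display} {Omega : measurableType d'}.
Variables (P : probability Omega R) (X : nat -> Omega -> S).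
Variable G : Omega -> tournament nat.
Hypothesis hG : is_G_infty mu W P X G.

(** [Av] is the event that no attempt succeeds, an attempt being a path from [i] to [j] through its
    own block of vertices numbered from [L] on. Given the types, the attempts use disjoint edges and
    are independent; integrating out the types of the blocks turns each failure probability into
    [1 - chain]. *)
Lemma unreachable_bound L (i j : 'I_L) (ks : seq nat) :
  i != j -> all (fun k => 0 < k)%N ks ->
  exists Av : set Omega, [/\ measurable Av,
    forall om, ~ reaches (G om) i j -> Av om &
    (P Av = \int[power_measure mu L]_s
      (\prod_(k <- ks) (1 - chain W mu k (tnth s i) (tnth s j)))%:E)%E].
Proof.
move=> ij ks0; set N := (L + sumn ks)%N.
have LN : (L <= N)%N by rewrite leq_addr.
(* The default of [insubd] is arbitrary; by [peN] every endpoint of an attempted edge is below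
   [N]. *)
pose o (a : nat) : 'I_N := insubd (widen_ord LN i) a.
have oK a : (a < N)%N -> val (o a) = a by move=> aN; rewrite val_insubd aN.
pose bs := blocks L ks.
have bsN b a : b \in bs -> a \in b -> (L <= a < N)%N.
  move=> bb ab; have : a \in flatten bs by apply/flattenP; exists b.
  by rewrite flatten_blocks mem_iota.
have peN b p : b \in bs -> p \in path_edges (i : nat) b j -> (p.1 < N)%N /\ (p.2 < N)%N.
  move=> bb /path_edges_mem[]; rewrite in_cons mem_rcons in_cons.
  have lt (a : 'I_L) : (a < N)%N by rewrite (leq_trans _ LN).
  have lb a : a \in b -> (a < N)%N by move=> /(bsN _ _ bb)/andP[].
  by move=> /orP[/eqP ->|/lb ?] /orP[/eqP ->|/lb ?].
pose oe (p : nat * nat) := (o p.1, o p.2).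
pose Es := [seq map oe (path_edges (i : nat) b j) | b <- bs].
pose avoids (F : tournament 'I_N) :=
  all (fun e => ~~ all (fun p => F p.1 p.2) e) Es.
exists [set om | avoids (restr G N om)]; split.
- exact: (measurable_restr hG avoids).
- move=> om nr; apply/allP => _ /mapP[b bb ->]; apply/negP => /allP h; apply: nr.
  exists (rcons b j); last by rewrite last_rcons.
  rewrite -all_path_edges; apply/allP => p pb.
  have [p1 p2] := peN _ _ bb pb.
  by have /= := h (oe p) (map_f _ pb); rewrite !oK.
rewrite (prob_restr mW W01 W_anti hG) sum_dens//.
have Ewf : uniq ([::] ++ flatten Es) /\
    {in [::] ++ flatten Es, forall p, (p.2, p.1) \notin [::] ++ flatten Es}.
  have -> : [::] ++ flatten Es =
      map oe (flatten [seq path_edges (i : nat) b j | b <- bs]).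
    by rewrite map_flatten -map_comp.
  set E := flatten _.
  have EN p : p \in E -> (p.1 < N)%N /\ (p.2 < N)%N.
    by move=> /flattenP[_ /mapP[b bb ->]]; exact: peN.
  have [uE aE] : uniq E /\ {in E, forall p, (p.2, p.1) \notin E}.
    have /andP[] : pairwise (@distinct_edges _) E && all (fun p => p.1 != p.2) E.
      apply: flatten_path_edges_distinct; first exact: blocks_neq0.
      rewrite /= !inE negb_or /bs flatten_blocks !mem_iota iota_uniq andbT.
      by rewrite (inj_eq val_inj) ij !negb_and -!ltnNge !ltn_ord.
    exact: distinct_edgesP.
  have oeK p q : p \in E -> q \in E -> oe p = oe q -> p = q.
    move=> /EN[p1 p2] /EN[q1 q2] [/(congr1 val) + /(congr1 val)].
    by rewrite /= !oK//; case: p q {p1 p2 q1 q2} => ? ? [? ?] /= -> ->.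
  split; first by rewrite map_inj_in_uniq.
  move=> _ /mapP[p pE ->]; apply/negP => /mapP[q qE].
  move=> [/(congr1 val) + /(congr1 val)] /=.
  have [p1 p2] := EN _ pE; have [q1 q2] := EN _ qE; rewrite !oK// => pq qp.
  by have := aE _ pE; rewrite pq qp -surjective_pairing qE.
transitivity (\int[power_measure mu N]_x
    (avoid_weight W (nth point x i) (nth point x j) ks (drop L x))%:E)%E.
  apply: eq_integral => x _; congr EFin.
  (* This gives the condition the form required by [sum_extensions_avoid] with an empty list of
     forced edges. *)
  rewrite -[LHS](eq_bigl _ _ (fun F => andTb (avoids F))).
  have := @sum_extensions_avoid _ _ _ (@kw_anti _ _ _ _ W_anti N x) [::] Es Ewf.1 Ewf.2.
  rewrite big_nil mul1r => ->; rewrite /Es big_map -prod_blocks; last first.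
    by rewrite size_tuple.
  rewrite !(big_seq_cond predT) /=; apply: eq_bigr => b; rewrite andbT => bb.
  congr (1 - _); rewrite -(prod_path_edges _ (nth point x)) big_map.
  rewrite !(big_seq_cond predT) /=; apply: eq_bigr => p; rewrite andbT => pb.
  by have [p1 p2] := peN _ _ bb pb; rewrite /kw !(tnth_nth point) !oK.
have mav : measurable_fun setT (fun x : N.-tuple S =>
    avoid_weight W (nth point x i) (nth point x j) ks (drop L x)).
  rewrite (_ : (fun _ => _) = (fun x : N.-tuple S => \prod_(b <- bs)
     (1 - \prod_(p <- path_edges (i : nat) b j) W (tnth x (o p.1), tnth x (o p.2))))).
    apply: measurable_prod => b _; apply: measurable_funB => //.
    by apply: measurable_prod => p _; exact: measurable_W_tnth.
  apply/funext => x; rewrite -prod_blocks; last by rewrite size_tuple.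
  rewrite !(big_seq_cond predT) /=; apply: eq_bigr => b; rewrite andbT => bb.
  congr (1 - _); rewrite -(prod_path_edges _ (nth point x)).
  rewrite !(big_seq_cond predT) /=; apply: eq_bigr => p; rewrite andbT => pb.
  by have [p1 p2] := peN _ _ bb pb; rewrite !(tnth_nth point) !oK.
rewrite (@integral_power_measure_cat _ _ _ mu L (sumn ks) (fun x : N.-tuple S =>
    (avoid_weight W (nth point x i) (nth point x j) ks (drop L x))%:E)); last 2 first.
- exact/measurable_EFinP.
- by move=> x; rewrite lee_fin avoid_weight_ge0.
apply: eq_integral => s _; rewrite -integral_avoid_weight//.
apply: eq_integral => t _ /=.
by rewrite drop_size_cat ?size_tuple// !nth_cat !size_tuple !ltn_ord -!tnth_nth.
Qed.

Hypothesis irr : irreducible_kernel mu W.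

Lemma ae_reaches (i j : nat) : i != j -> {ae P, forall om, reaches (G om) i j}.
Proof.
move=> ij; pose L := (maxn i j).+1.
have iL : (i < L)%N by rewrite ltnS leq_maxl.
have jL : (j < L)%N by rewrite ltnS leq_maxr.
pose oi := Ordinal iL; pose oj := Ordinal jL.
have oij : oi != oj by [].
(* The length given by [ae_linked] depends on the types, so stage [M] tries every length from 1 to
   [M], and each of them [M] times. Once [M] exceeds [k], the factor [1 - c] occurs [M] times and
   the product is at most [(1 - c) ^+ M]. *)
pose ks M := flatten (nseq M (iota 1 M)).
have ks0 M : all (fun k => 0 < k)%N (ks M).
  apply/allP => k /flattenP[l /nseqP[-> _]]; rewrite mem_iota => /andP[]//.
pose Av M := sval (cid (unreachable_bound oij (ks0 M))).
have [mAv nAv PAv] : [/\ forall M, measurable (Av M),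
   forall M om, ~ reaches (G om) i j -> Av M om &
   forall M, (P (Av M) = \int[power_measure mu L]_s (\prod_(k <- ks M)
     (1 - chain W mu k (tnth s oi) (tnth s oj)))%:E)%E].
  by split=> M; rewrite /Av; case: cid => A [].
pose u M (s : L.-tuple S) : R :=
  \prod_(k <- ks M) (1 - chain W mu k (tnth s oi) (tnth s oj)).
have f01 k x y : 0 <= 1 - chain W mu k x y <= 1.
  have /andP[c0 c1] := chain01 mu mW W01 k x y.
  by rewrite subr_ge0 c1 gerBl.
have u01 M s : 0 <= u M s <= 1.
  by rewrite prodr_ge0 ?prodr_ile1// => k _; case/andP: (f01 k (tnth s oi) (tnth s oj)).
have mu_ M : measurable_fun setT (fun s => (u M s)%:E).
  apply/measurable_EFinP; apply: measurable_prod => k _; apply: measurable_funB => //.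
  exact: (measurableT_comp (measurable_chain mu mW W01 k) (measurable_tnth_pair oi oj)).
have u_cvg : {ae power_measure mu L, forall s, setT s -> (u M s)%:E @[M --> \oo] --> 0%E}.
  apply: filterS (ae_pairs L (ae_linked mW W01 W_anti irr)) => s /(_ oi oj oij).
  move=> [k ck] _; apply: cvg_EFin; first exact: nearW.
  pose c := chain W mu k.+1 (tnth s oi) (tnth s oj).
  have {}ck : 0 < c by exact: ck.
  have /andP[c0 c1] : 0 <= 1 - c <= 1 by exact: f01.
  apply: (@squeeze_cvgr _ _ _ _ (fun=> 0) (fun M => (1 - c) ^+ M)).
  - near=> M; have /andP[-> _]/= := u01 M s.
    rewrite /u /ks big_flatten/= big_nseq iter_mulr_1.
    apply: lerXn2r; rewrite ?nnegrE//.
      by apply: prodr_ge0 => k' _; case/andP: (f01 k' (tnth s oi) (tnth s oj)).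
    rewrite (big_rem k.+1)/=; last first.
      rewrite mem_iota /= add1n ltnS; near: M; exact: nbhs_infty_ge.
    rewrite ler_piMr//; apply: prodr_ile1 => k' _; exact: f01.
  - exact: cvg_cst.
  - by apply: cvg_expr; rewrite ger0_norm//; rewrite ltrBlDr ltrDl.
have ig1 : (power_measure mu L).-integrable setT (cst 1%E : L.-tuple S -> \bar R).
  exact: finite_measure_integrable_cst.
have ule1 : {ae power_measure mu L, forall s M, setT s -> (`|(u M s)%:E| <= cst 1 s)%E}.
  by apply: aeW => s M _; rewrite /= lee_fin ger0_norm; case/andP: (u01 M s).
(* The products are bounded by 1 and tend to 0 for almost all types, so the probability of [Av M]
   tends to 0, and each [Av M] contains the event that [j] is not reached. *)
have [_ _] := @dominated_convergence _ _ _ (power_measure mu L) setT measurableT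
  (fun M s => (u M s)%:E) (cst 0%E) (cst 1%E) mu_ (measurable_cst _) u_cvg ig1 ule1.
rewrite integral0 => PAv0.
have mcap : measurable (\bigcap_M Av M) by exact: bigcapT_measurable.
exists (\bigcap_M Av M); split => //; last by move=> om nr M _; exact: nAv.
apply/eqP; rewrite eq_le measure_ge0 andbT.
apply: (cvge_to_ge PAv0); apply: nearW => M; rewrite /= -PAv le_measure ?inE//.
exact: bigcap_inf.
Unshelve. all: by end_near. Qed.

Lemma ae_irreducible : {ae P, forall om, irreducible_tournament (G om)}.
Proof.
have h : {ae P, forall om, forall i j : nat, i != j -> reaches (G om) i j}.
  apply: ae_foralln => i; apply: ae_foralln => j.
  have [->|ij] := eqVneq i j; first exact: aeW.
  by apply: filterS (ae_reaches ij) => om.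
apply: filterS h => om hr [A [[x Ax] [y nAy] hA]].
have yx : y != x by apply/eqP => yx; apply: nAy; rewrite yx.
have [p] := hr _ _ yx.
elim: p y nAy {yx} => [|z p IH] y nAy /=; first by move=> _ yx; apply: nAy; rewrite yx.
move=> /andP[yz zp]; apply: (IH z) => // Az.
have := hA _ _ Az nAy; rewrite tournament_anti ?yz//.
by apply/eqP => zy; apply: nAy; rewrite -zy.
Qed.

End reachability.

(** * Antisymmetrization *)

Section antisymmetrization.
Context {R : realType} {d : measure_display} {S : measurableType d}.
Variables (mu : probability S R) (W : S * S -> R).
Hypothesis W_kernel : tournament_kernel mu W.

Definition antisym (z : S * S) : R := (W z + 1 - W (z.2, z.1)) / 2.

Let mW : measurable_fun setT W. Proof. by case: W_kernel. Qed.
Let W01 z : 0 <= W z <= 1. Proof. by case: W_kernel. Qed.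

Lemma measurable_antisym : measurable_fun setT antisym.
Proof.
apply: measurable_funM => //; apply: measurable_funB; first exact: measurable_funD.
by apply: (measurableT_comp mW); exact: measurable_fun_pair.
Qed.

Lemma antisym01 z : 0 <= antisym z <= 1.
Proof.
have /andP[a0 a1] := W01 z; have /andP[b0 b1] := W01 (z.2, z.1).
by rewrite /antisym; apply/andP; split; lra.
Qed.

Lemma antisymE x y : antisym (x, y) + antisym (y, x) = 1.
Proof. by rewrite /antisym /=; lra. Qed.

Lemma ae_antisym : {ae (mu \x mu)%E, forall z, antisym z = W z}.
Proof.
case: W_kernel => _ _; apply: filterS => -[x y] /= h.
by rewrite /antisym /=; lra.
Qed.

Lemma ae_antisym_tnth n : {ae power_measure mu n, forall x : n.-tuple S,
  forall i j, i != j -> antisym (tnth x i, tnth x j) = W (tnth x i, tnth x j)}.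
Proof. exact: ae_pairs ae_antisym. Qed.

(** Edges of a tournament join distinct vertices, so equality almost everywhere at pairs of distinct
    coordinates is enough. *)
Lemma represents_antisym (Gamma : tournament_limit R) : represents mu W Gamma ->
  forall k (F : tournament 'I_k), t_ind Gamma F = dens antisym mu F.
Proof.
move=> WG k F; apply: EFin_inj; rewrite WG densE; last 2 first.
- exact: measurable_antisym.
- exact: antisym01.
apply: ge0_ae_eq_integral => //.
- exact: (emeasurable_weight mW F).
- exact: (emeasurable_weight measurable_antisym F).
- by move=> x _; rewrite lee_fin; exact: (weight_ge0 W01).
- by move=> x _; rewrite lee_fin; exact: (weight_ge0 antisym01).
apply: filterS (ae_antisym_tnth k) => x h _; congr EFin; apply: eq_bigr => p Fp.
by rewrite /kw h//; apply: contraTneq Fp => ->; rewrite tournament_irr.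
Qed.

Lemma reducible_kernel_antisym : reducible_kernel mu W <-> reducible_kernel mu antisym.
Proof.
by split=> -[B [mB muB hB]]; exists B; split=> //;
  apply: filterS2 ae_antisym hB => z e h /h; rewrite e.
Qed.

Lemma is_G_infty_antisym d' (Omega : measurableType d') (P : probability Omega R)
    (X : nat -> Omega -> S) (G : Omega -> tournament nat) :
  is_G_infty mu W P X G <-> is_G_infty mu antisym P X G.
Proof.
have E n (F : tournament 'I_n) (A : 'I_n -> set S) : (forall i, measurable (A i)) ->
    (\int[power_measure mu n]_(x in box A) (edge_prod W F x)%:E =
     \int[power_measure mu n]_(x in box A) (edge_prod antisym F x)%:E)%E.
  move=> mA; apply: ge0_ae_eq_integral.
  - exact: measurable_box.
  - by apply: measurable_funTS; apply/measurable_EFinP; exact: measurable_edge_prod.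
  - apply: measurable_funTS; apply/measurable_EFinP.
    exact: (measurable_edge_prod measurable_antisym).
  - by move=> x _; rewrite lee_fin; exact: (edge_prod_ge0 W01).
  - by move=> x _; rewrite lee_fin; exact: (edge_prod_ge0 antisym01).
  apply: filterS (ae_antisym_tnth n) => x h _; congr EFin.
  by apply: eq_bigr => p p12; rewrite h// -val_eqE neq_ltn p12.
split=> -[mX mG PE]; split=> // n F A mA; rewrite PE//.
  exact: (E _ F _ mA).
exact: (esym (E _ F _ mA)).
Qed.

End antisymmetrization.

Theorem theorem8p4 (R : realType) (d : measure_display) (S : measurableType d)
    (mu : probability S R) (W : S * S -> R) (Gamma : tournament_limit R)
    (W_kernel : tournament_kernel mu W) (W_Gamma : represents mu W Gamma) :
  [<-> irreducible_limit Gamma;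
       irreducible_kernel mu W;
       G_infty_as_irreducible mu W].
Proof.
have mV := measurable_antisym W_kernel.
have V01 := antisym01 W_kernel.
have V_anti := @antisymE R d S W.
have GE := represents_antisym W_kernel W_Gamma.
tfae.
- move=> irrG /(reducible_kernel_antisym W_kernel) [B [mB muB VB]]; apply: irrG.
  exact: (reducible_dens mV V01 V_anti mB muB VB GE).
- move=> irrW d' Omega P X G /(is_G_infty_antisym W_kernel) hG.
  apply: (ae_irreducible mV V01 V_anti hG).
  by move=> /(reducible_kernel_antisym W_kernel).
- move=> irrG redG; apply: (reducible_realization mV V01 V_anti GE redG).
  by move=> d' Omega P X G /(is_G_infty_antisym W_kernel); exact: irrG.
Qed.
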